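(* Let $N\geq 3$ and $M\geq 0$ be integers and let $p\in\left(p_{sg}(N),p_{JL}(N)\right)$. Let $u$ be a real-valued classical ($C^2$) solution of $$\Delta u+|u|^{p-1}u=0,\qquad z=(x,y)\in\mathbb{R}^{N+M},\quad x\in\mathbb{R}^N,\ y\in\mathbb{R}^M,$$ such that $$|u(x,y)|\leq \varphi_\infty(x)\qquad\text{for all } x\in\mathbb{R}^N\setminus\{0\},\ y\in\mathbb{R}^M.$$ Then $u\equiv 0$ on $\mathbb{R}^{N+M}$.
   Context: For $N\ge 3$, the Serrin exponent is $p_{sg}(N)=\frac{N}{N-2}$, and the Joseph--Lundgren exponent is $$p_{JL}(N)=\begin{cases}\dfrac{(N-2)^2-4N+8\sqrt{N-1}}{(N-2)(N-10)} & \text{if } N>10,\\[2mm] \infty & \text{if } N\leq 10.\end{cases}$$ For $p>p_{sg}(N)$, the radial singular steady state in $\mathbb{R}^N$ is $$\varphi_\infty(x)=L|x|^{-2/(p-1)},\qquad L=\left(\frac{2}{p-1}\left(N-2-\frac{2}{p-1}\right)\right)^{1/(p-1)},\qquad x\in\mathbb{R}^N\setminus\{0\}.$$ Here $\Delta$ is the Laplacian in all $N+M$ variables $(x,y)$. When $M=0$ the variable $y$ is absent and $u=u(x)$ is a function on $\mathbb{R}^N$. *)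

(* Defs.v *)
From HB Require Import structures.
From mathcomp Require Import all_boot all_order all_algebra.
From mathcomp Require Import all_classical all_reals all_analysis.

Set Implicit Arguments.
Unset Strict Implicit.
Unset Printing Implicit Defensive.

Import Order.TTheory GRing.Theory Num.Theory.
Import numFieldNormedType.Exports.

Local Open Scope classical_set_scope.
Local Open Scope ring_scope.

(* The library norm `|x| on 'rV[R]_n is the sup norm. *)
Definition euclid_norm (R : realType) (n : nat) (x : 'rV[R]_n) : R :=
  Num.sqrt (\sum_(i < n) x ord0 i ^+ 2).

Definition basis_vec (R : realType) (n : nat) (i : 'I_n) : 'rV[R]_n :=
  delta_mx ord0 i.

Definition partial (R : realType) (n : nat) (i : 'I_n) (u : 'rV[R]_n -> R) :
    'rV[R]_n -> R :=
  'D_(basis_vec R i) u.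

(* C^k through iterated partials.  'D_v u is total (junk where the limit does
   not exist), so existence of each partial is required separately. *)
Fixpoint class_C (R : realType) (n k : nat) (u : 'rV[R]_n -> R) : Prop :=
  match k with
  | 0 => continuous u
  | k'.+1 => continuous u /\
      forall i : 'I_n,
        (forall z : 'rV[R]_n, derivable u z (basis_vec R i)) /\
        class_C k' (partial i u)
  end.

Definition laplacian (R : realType) (n : nat) (u : 'rV[R]_n -> R)
    (z : 'rV[R]_n) : R :=
  \sum_(i < n) partial i (partial i u) z.

Definition p_sg (R : realType) (N : nat) : R := N%:R / (N%:R - 2).

Definition p_JL (R : realType) (N : nat) : \bar R :=
  if (10 < N)%N then
    (((N%:R - 2) ^+ 2 - 4 * N%:R + 8 * Num.sqrt (N%:R - 1))
       / ((N%:R - 2) * (N%:R - 10)))%:E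
  else +oo%E.

Definition L_const (R : realType) (N : nat) (p : R) : R :=
  ((2 / (p - 1)) * (N%:R - 2 - 2 / (p - 1))) `^ (1 / (p - 1)).

Definition phi_infty (R : realType) (N : nat) (p : R) (x : 'rV[R]_N) : R :=
  L_const N p * euclid_norm x `^ (- 2 / (p - 1)).

(* Main.v *)
Require Import Defs.
From HB Require Import structures.
From mathcomp Require Import all_boot all_order all_algebra.
From mathcomp Require Import all_classical all_reals all_analysis.
From mathcomp Require Import ring lra.

Set Implicit Arguments.
Unset Strict Implicit.
Unset Printing Implicit Defensive.

Import Order.TTheory GRing.Theory Num.Theory.
Import numFieldNormedType.Exports.

Local Open Scope classical_set_scope.
Local Open Scope ring_scope.

(** Write phi for the singular solution, sg = 1 / (p - 1) for its decay
    exponent as a power of |x|^2, and ell = 2 sg (N - 2 - 2 sg), so that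
    phi^(p-1) = ell / |x|^2.  The proof studies the quotient v = u / phi.  It
    takes its values in [-1, 1], and since phi blows up on the axis x = 0 while
    u does not, v extends continuously by 0 to that axis.

    Every step slides an explicit function of |x|^2 and |y - c|^2 onto u until
    it touches u from above: at a touching point the Laplacian of u is at most
    that of the explicit function [laplacian_le_of_touching].  The
    unbounded directions, including those of y, are handled by the growth of the
    explicit functions.

    The goal is v <= 0; applied to -u it gives v = 0.

    (1) Barrier [ratio_le0_barrier].  Compare u with
    phi (T |y - y0|^2 + K (T |x|^2)^k).  This is above u where the bracket is at
    least 1; elsewhere it behaves, for K large, as a strict supersolution of the
    equation for u provided 2k (2k - b) < c, where b = 4 sg - N + 2 and c >= 0
    is a constant with c v <= ell (v - v^p) wherever v > 0.  Hence v is at most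
    the bracket, and T -> 0 yields v <= 0 off the axis.

    If b > 0, i.e. if p is Sobolev subcritical in dimension N, the choice c = 0
    and k small works because 0 < v <= 1.  If b <= 0, one needs c > 0, that is,
    v bounded away from 1.

    (2) Gap below 1 [ratio_gap].  First v < 1, by a strong maximum principle
    for the superharmonic function phi - u [ratio_lt1].  Next, linearizing at
    phi produces the potential p ell / |x|^2, and for b <= 0 the condition
    p < p_JL says exactly that p ell exceeds the Hardy constant (N - 2)^2 / 4
    [hardy_of_p_JL].  So for each point z0 off the axis there is a bump Psi,
    positive at z0 and compactly supported off the axis, with
    Lap Psi >= - mu Psi / |x|^2 and mu < p ell.  At a point where the largest
    multiple of Psi lying below phi - u touches it,
    ell (1 - |v|^(p-1) v) <= mu (1 - v), which forbids v close to 1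
    since the left side is about p ell (1 - v) there.  The bumps are
    rescalings of each other, so the resulting lower bound for 1 - v is the same
    at every point. *)

(** * One-variable calculus *)

(** Derivation rules for pointwise expressions, stated with the product of the
    field instead of scaling, so that the derivatives are polynomial terms. *)
Lemma derD (R : realType) (f g : R -> R) (x a b : R) :
  is_derive (x : R) 1 f a -> is_derive (x : R) 1 g b ->
  is_derive (x : R) 1 (fun t : R => f t + g t : R) (a + b : R).
Proof. exact: is_deriveD. Qed.

Lemma derM (R : realType) (f g : R -> R) (x a b : R) :
  is_derive (x : R) 1 f a -> is_derive (x : R) 1 g b ->
  is_derive (x : R) 1 (fun t : R => f t * g t : R) (a * g x + f x * b : R).
Proof.
move=> df dg; apply: (is_derive_eq (is_deriveM df dg)).
by rewrite addrC; congr (_ + _); rewrite /GRing.scale/= mulrC.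
Qed.

Lemma derZ (R : realType) (k : R) (f : R -> R) (x a : R) :
  is_derive (x : R) 1 f a ->
  is_derive (x : R) 1 (fun t : R => k * f t : R) (k * a : R).
Proof. exact: is_deriveZ. Qed.

Lemma derC (R : realType) (k x : R) :
  is_derive (x : R) 1 (fun=> k : R) (0 : R).
Proof. exact: is_derive_cst. Qed.

Lemma der_pow (R : realType) (a x : R) : 0 < x ->
  is_derive (x : R) 1 (fun t : R => t `^ a) (a * (x `^ a / x) : R).
Proof.
move=> x0; apply: (is_derive_eq (is_derive1_powR a x0)).
by rewrite powRB ?powRr1 ?ltW// (gt_eqF x0) implybT.
Qed.

Lemma der_powdiv (R : realType) (a x : R) : 0 < x ->
  is_derive (x : R) 1 (fun t : R => t `^ a / t) ((a - 1) * (x `^ a / x / x) : R).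
Proof.
move=> x0.
have xn0 : (@id R) x != 0 by rewrite gt_eqF.
have dV := derM (der_pow a x0) (is_deriveV xn0 (is_derive_id (x : R) 1)).
apply: (is_derive_eq dV); rewrite /GRing.scale/=; field.
by rewrite gt_eqF.
Qed.

Lemma der_expR (R : realType) (k x : R) :
  is_derive (x : R) 1 (fun t : R => expR (k * t)) (k * expR (k * x) : R).
Proof.
have dk : is_derive (x : R) 1 (fun t : R => k * t) (k * 1 : R).
  by apply: derZ; exact: is_derive_id.
apply: (is_derive_eq (is_derive1_comp (is_derive_expR (k * x)) dk)).
by rewrite mulr1 mulrC.
Qed.

Lemma second_derivative_at_min (R : realType) (F F1 : R -> R) (F2 : R) :
  (\forall t \near (0 : R), is_derive (t : R) 1 F (F1 t)) ->
  is_derive (0 : R) 1 F1 F2 ->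
  (\forall t \near (0 : R), F 0 <= F t) -> 0 <= F2.
Proof.
move=> dF dF1 Fmin.
have /nbhs_ballP[d /= d0 near_dP] : \forall t \near (0 : R),
    is_derive (t : R) 1 F (F1 t) /\ F 0 <= F t.
  by near=> t; split; near: t.
have dP t : `|t| < d -> is_derive (t : R) 1 F (F1 t) /\ F 0 <= F t.
  by move=> td; apply: near_dP; rewrite /ball/= sub0r normrN.
have F10 : F1 0 = 0.
  have [_ <-] : is_derive (0:R) 1 F (F1 0).
    by apply: (dP _ _).1; rewrite normr0; lra.
  suff [_ ->] : is_derive (0:R) 1 F 0 by [].
  apply: (@derive1_at_min _ F (- d) d) => //.
  - by lra.
  - move=> t; rewrite in_itv/= => /andP[t1 t2].
    by have [|[]] := dP t; first by rewrite ltr_norml t1.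
  - by rewrite in_itv/=; lra.
  - move=> t; rewrite in_itv/= => /andP[t1 t2].
    by have [|] := dP t; first by rewrite ltr_norml t1.
rewrite leNgt; apply/negP => F2lt0.
have [e /= e0 eP] : \forall h \near (0:R)^', h^-1 * F1 h < 0.
  have [df dfE] := dF1.
  have : h^-1 *: (F1 (h *: 1 + 0) - F1 0) @[h --> (0:R)^'] --> F2.
    by rewrite -dfE; exact: df.
  move=> /cvgr_lt /(_ _ F2lt0); apply: filterS => h.
  by rewrite F10 subr0 addr0 [h *: 1]mulr1.
pose b := Num.min (d / 2) (e / 2).
have b0 : 0 < b by rewrite lt_min; apply/andP; split; lra.
have bd : b <= d / 2 by rewrite ge_min lexx.
have be : b <= e / 2 by rewrite ge_min lexx orbT.
have dFb t : t \in `]0, b[ -> is_derive (t : R) 1 F (F1 t).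
  rewrite in_itv/= => /andP[t1 t2].
  by apply: (dP _ _).1; rewrite gtr0_norm//; lra.
have cF : {within `[0, b], continuous F}.
  apply: continuous_in_subspaceT => t; rewrite inE/= in_itv/= => /andP[t1 t2].
  apply: differentiable_continuous; apply/derivable1_diffP.
  by have [|[]] := dP t; first by rewrite ger0_norm//; lra.
have [t] := MVT b0 dFb cF.
rewrite in_itv/= => /andP[t1 t2]; rewrite subr0 => Et.
have Fb : F 0 <= F b by apply: (dP _ _).2; rewrite gtr0_norm//; lra.
have : t^-1 * F1 t < 0.
  by apply: eP; rewrite /= ?sub0r ?normrN ?gtr0_norm ?gt_eqF//; lra.
rewrite pmulr_rlt0 ?invr_gt0// => F1t.
have : F1 t * b < 0 by rewrite nmulr_rlt0.
by lra.
Unshelve. all: by end_near. Qed.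

Lemma is_derive_line (R : realType) (n : nat) (u : 'rV[R]_n -> R) z v t :
  derivable u (z + t *: v) v ->
  is_derive (t : R) 1 (fun s : R => u (z + s *: v)) ('D_v u (z + t *: v)).
Proof.
move=> du.
have E : (fun h : R => h^-1 *: (u (z + (h *: 1 + t) *: v) - u (z + t *: v)))
       = (fun h : R => h^-1 *: (u (h *: v + (z + t *: v)) - u (z + t *: v))).
  apply/funext => h; congr (_ *: (u _ - _)).
  by rewrite [h *: 1]mulr1 scalerDl addrCA.
by split; rewrite /derivable /derive/= E.
Qed.

(** In one coordinate direction |x|^2 and |y - c|^2 are monic quadratics of the
    line parameter; this is why the bound B is composed with
    q + 2 a t + t^2. *)
Lemma touching_line (R : realType) (n : nat) (u : 'rV[R]_n -> R) z v
    (B B1 : R -> R) (b2 q a : R) :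
  (forall t : R, derivable u (z + t *: v) v) -> derivable ('D_v u) z v ->
  (\forall t \near q, is_derive (t : R) 1 B (B1 t)) -> is_derive (q : R) 1 B1 b2 ->
  (\forall t \near (0 : R), u (z + t *: v) <= B (q + 2 * a * t + t ^+ 2)) ->
  u z = B q ->
  'D_v ('D_v u) z <= 4 * a ^+ 2 * b2 + 2 * B1 q.
Proof.
move=> du ddu dB dB1 le_u eq_u.
pose s t : R := q + 2 * a * t + t ^+ 2.
have s0 : s 0 = q by rewrite /s; ring.
have ds t : is_derive (t : R) 1 s (2 * a + 2 * t).
  by rewrite /s; apply: is_derive_eq; rewrite ![_ *: _]mulr1 ?scaler0; ring.
have cs : s t @[t --> (0 : R)] --> q.
  rewrite -[X in _ --> X]s0.
  by apply/differentiable_continuous/derivable1_diffP; case: (ds 0).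
rewrite -subr_ge0.
pose F t := B (s t) - u (z + t *: v).
pose F1 t := B1 (s t) * (2 * a + 2 * t) - 'D_v u (z + t *: v).
apply: (@second_derivative_at_min _ F F1).
- have near_s : \forall t \near (0 : R), is_derive (s t) 1 B (B1 (s t)).
    exact: cs _ dB.
  apply: filterS near_s => t dBt.
  exact: (is_deriveB (is_derive1_comp dBt (ds t)) (is_derive_line (du t))).
- have dBs : is_derive (0 : R) 1 (B1 \o s) (b2 * (2 * a + 2 * 0)).
    by apply: is_derive1_comp (ds 0); rewrite s0.
  have dl : is_derive (0 : R) 1 (fun t : R => 2 * a + 2 * t) 2.
    by apply: is_derive_eq; rewrite /GRing.scale/=; ring.
  have ddu0 : is_derive (0 : R) 1 (fun t : R => 'D_v u (z + t *: v))
      ('D_v ('D_v u) z).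
    have z0 : z + (0 : R) *: v = z by rewrite scale0r addr0.
    have ddu' : derivable ('D_v u) (z + (0 : R) *: v) v by rewrite z0.
    by have := is_derive_line ddu'; rewrite z0.
  apply: (is_derive_eq (is_deriveB (is_deriveM dBs dl) ddu0)).
  by rewrite /= s0 /GRing.scale/=; ring.
- have -> : F 0 = 0 by rewrite /F s0 scale0r addr0 eq_u subrr.
  by apply: filterS le_u => t; rewrite /F subr_ge0.
Qed.

(** * Squared distances and the touching principle *)

Definition sqx (R : realType) (N M : nat) (z : 'rV[R]_(N + M)) : R :=
  \sum_(i < N) z ord0 (lshift M i) ^+ 2.

(** The squared distance between the y-components only: the x-components of
    [c] do not enter. *)
Definition sqy (R : realType) (N M : nat) (c z : 'rV[R]_(N + M)) : R :=
  \sum_(j < M) (z ord0 (rshift N j) - c ord0 (rshift N j)) ^+ 2.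

Lemma sqx_ge0 (R : realType) (N M : nat) (z : 'rV[R]_(N + M)) : 0 <= sqx z.
Proof. by apply: sumr_ge0 => i _; exact: sqr_ge0. Qed.

Lemma sqy_ge0 (R : realType) (N M : nat) (c z : 'rV[R]_(N + M)) :
  0 <= sqy c z.
Proof. by apply: sumr_ge0 => i _; exact: sqr_ge0. Qed.

Lemma sqy_center (R : realType) (N M : nat) (c : 'rV[R]_(N + M)) :
  sqy c c = 0.
Proof. by apply: big1 => j _; rewrite subrr expr0n. Qed.

Lemma coord_sqr_le_sqx (R : realType) (N M : nat) (z : 'rV[R]_(N + M))
    (i : 'I_N) :
  z ord0 (lshift M i) ^+ 2 <= sqx z.
Proof.
by rewrite /sqx (bigD1 i)//= lerDl sumr_ge0// => *; exact: sqr_ge0.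
Qed.

Lemma coord_sqr_le_sqy (R : realType) (N M : nat) (c z : 'rV[R]_(N + M))
    (j : 'I_M) :
  (z ord0 (rshift N j) - c ord0 (rshift N j)) ^+ 2 <= sqy c z.
Proof.
by rewrite /sqy (bigD1 j)//= lerDl sumr_ge0// => *; exact: sqr_ge0.
Qed.

Lemma sqx_eq0_coord (R : realType) (N M : nat) (z : 'rV[R]_(N + M))
    (i : 'I_N) :
  sqx z = 0 -> z ord0 (lshift M i) = 0.
Proof.
move=> z0; apply/eqP; rewrite -sqrf_eq0 eq_le sqr_ge0 andbT -z0.
exact: coord_sqr_le_sqx.
Qed.

Lemma continuous_sqx (R : realType) (N M : nat) :
  continuous (@sqx R N M).
Proof.
rewrite /sqx; apply: continuous_big => [|i _ z]; first exact: add_continuous.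
exact: (continuous_comp (@coord_continuous _ _ _ _ _ z)
  (@exprn_continuous _ 2 _)).
Qed.

Lemma continuous_sqy (R : realType) (N M : nat) (c : 'rV[R]_(N + M)) :
  continuous (sqy c).
Proof.
rewrite /sqy; apply: continuous_big => [|i _ z]; first exact: add_continuous.
apply: (@continuous_comp _ _ _
  (fun z' : 'rV[R]_(N + M) => z' ord0 (rshift N i) - c ord0 (rshift N i))
  (fun t => t ^+ 2)); last exact: exprn_continuous.
by apply: continuousB; [exact: coord_continuous|exact: cst_continuous].
Qed.

Lemma basis_vecE (R : realType) (n : nat) (i k : 'I_n) (z : 'rV[R]_n) t :
  (z + t *: basis_vec R i) ord0 k = z ord0 k + t * (k == i)%:R.
Proof. by rewrite /basis_vec !mxE eqxx. Qed.

Lemma sqx_linel (R : realType) (N M : nat) (i : 'I_N)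
    (z : 'rV[R]_(N + M)) (t : R) :
  sqx (z + t *: basis_vec R (lshift M i)) =
  sqx z + 2 * z ord0 (lshift M i) * t + t ^+ 2.
Proof.
rewrite /sqx (bigD1 i)//= [in RHS](bigD1 i)//= basis_vecE eqxx mulr1.
rewrite (eq_bigr (fun k : 'I_N => z ord0 (lshift M k) ^+ 2)); first by ring.
move=> k ki; rewrite basis_vecE (inj_eq (@lshift_inj _ _)) (negbTE ki).
by rewrite mulr0 addr0.
Qed.

Lemma sqx_liner (R : realType) (N M : nat) (j : 'I_M)
    (z : 'rV[R]_(N + M)) (t : R) :
  sqx (z + t *: basis_vec R (rshift N j)) = sqx z.
Proof.
rewrite /sqx; apply: eq_bigr => k _.
by rewrite basis_vecE eq_lrshift mulr0 addr0.
Qed.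

Lemma sqy_linel (R : realType) (N M : nat) (i : 'I_N)
    (c z : 'rV[R]_(N + M)) (t : R) :
  sqy c (z + t *: basis_vec R (lshift M i)) = sqy c z.
Proof.
rewrite /sqy; apply: eq_bigr => k _.
by rewrite basis_vecE eq_rlshift mulr0 addr0.
Qed.

Lemma sqy_liner (R : realType) (N M : nat) (j : 'I_M)
    (c z : 'rV[R]_(N + M)) (t : R) :
  sqy c (z + t *: basis_vec R (rshift N j)) =
  sqy c z + 2 * (z ord0 (rshift N j) - c ord0 (rshift N j)) * t + t ^+ 2.
Proof.
rewrite /sqy (bigD1 j)//= [in RHS](bigD1 j)//= basis_vecE eqxx mulr1.
rewrite (eq_bigr (fun k : 'I_M =>
  (z ord0 (rshift N k) - c ord0 (rshift N k)) ^+ 2)); first by ring.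
move=> k kj; rewrite basis_vecE (inj_eq (@rshift_inj _ _)) (negbTE kj).
by rewrite mulr0 addr0.
Qed.

Lemma near_line (R : realType) (n : nat) (z v : 'rV[R]_n)
    (D : set 'rV[R]_n) :
  nbhs z D -> \forall t \near (0 : R), D (z + t *: v).
Proof.
move=> Dz.
have : z + t *: v @[t --> (0 : R)] --> z.
  rewrite -[X in _ --> X]addr0 -(scale0r v).
  apply: cvgD; first exact: cvg_cst.
  exact: scalel_continuous.
exact.
Qed.

(** The comparison principle behind all the estimates.  Test functions of the
    form A(|x|^2) + G(|x|^2) P(|y - c|^2) suffice, and their Laplacian is the
    bound stated here: a radial function F(|x|^2) on R^N has Laplacian
    4 q F''(q) + 2 N F'(q) with q = |x|^2. *)
Lemma laplacian_le_of_touching (R : realType) (N M : nat) (u : 'rV[R]_(N + M) -> R)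
    (c z : 'rV[R]_(N + M)) (A A1 A2 G G1 G2 P P1 P2 : R -> R) :
  class_C 2 u -> 0 < sqx z ->
  (forall t : R, 0 < t -> is_derive (t : R) 1 A (A1 t)) ->
  (forall t : R, 0 < t -> is_derive (t : R) 1 A1 (A2 t)) ->
  (forall t : R, 0 < t -> is_derive (t : R) 1 G (G1 t)) ->
  (forall t : R, 0 < t -> is_derive (t : R) 1 G1 (G2 t)) ->
  (forall t : R, is_derive (t : R) 1 P (P1 t)) ->
  (forall t : R, is_derive (t : R) 1 P1 (P2 t)) ->
  (\forall z' \near z, u z' <= A (sqx z') + G (sqx z') * P (sqy c z')) ->
  u z = A (sqx z) + G (sqx z) * P (sqy c z) ->
  laplacian u z <=
    (4 * sqx z * A2 (sqx z) + 2 * N%:R * A1 (sqx z)) +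
    (4 * sqx z * G2 (sqx z) + 2 * N%:R * G1 (sqx z)) * P (sqy c z) +
    G (sqx z) * (4 * sqy c z * P2 (sqy c z) + 2 * M%:R * P1 (sqy c z)).
Proof.
move=> [_ uC] z0 dA dA1 dG dG1 dP dP1 le_u eq_u.
have du k z' : derivable u z' (basis_vec R k) by case: (uC k).
have ddu k : derivable ('D_(basis_vec R k) u) z (basis_vec R k).
  by case: (uC k) => _ [_ /(_ k)[]].
rewrite /laplacian big_split_ord/=.
set q := sqx z; set s := sqy c z.
pose a2 := A2 q + G2 q * P s; pose a1 := A1 q + G1 q * P s.
pose b2 := G q * P2 s; pose b1 := G q * P1 s.
have hx (i : 'I_N) : partial (lshift M i) (partial (lshift M i) u) z <=
    4 * z ord0 (lshift M i) ^+ 2 * a2 + 2 * a1.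
  apply: (@touching_line _ _ u z _ (fun t => A t + G t * P s)
    (fun t => A1 t + G1 t * P s)) => //.
  - near=> t; have t0 : 0 < t by near: t; exact: lt_nbhsr.
    apply: (is_derive_eq (derD (dA _ t0) (derM (dG _ t0) (derC (P s) _)))).
    by rewrite mulr0 addr0.
  - apply: (is_derive_eq (derD (dA1 _ z0) (derM (dG1 _ z0) (derC (P s) _)))).
    by rewrite mulr0 addr0.
  - have := near_line (basis_vec R (lshift M i)) le_u.
    by apply: filterS => t; rewrite sqx_linel sqy_linel.
have hy (j : 'I_M) : partial (rshift N j) (partial (rshift N j) u) z <=
    4 * (z ord0 (rshift N j) - c ord0 (rshift N j)) ^+ 2 * b2 + 2 * b1.
  apply: (@touching_line _ _ u z _ (fun t => A q + G q * P t)
    (fun t => G q * P1 t) _ s) => //.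
  - near=> t.
    by apply: (is_derive_eq (derD (derC (A q) _) (derZ (G q) (dP t))));
       rewrite add0r.
  - have := near_line (basis_vec R (rshift N j)) le_u.
    by apply: filterS => t; rewrite sqx_liner sqy_liner.
apply: le_trans (lerD (ler_sum _ (fun i _ => hx i))
                      (ler_sum _ (fun j _ => hy j))) _.
rewrite !big_split/= !sumr_const !card_ord.
under eq_bigr do rewrite mulrAC; rewrite -mulr_sumr -/(sqx z) -/q.
under eq_bigr do rewrite mulrAC; rewrite -mulr_sumr -/(sqy c z) -/s.
rewrite /a2 /a1 /b2 /b1 -[_ *+ N]mulr_natr -[_ *+ M]mulr_natr le_eqVlt.
apply/orP; left; apply/eqP.
by ring.
Unshelve. all: by end_near. Qed.

Lemma near_sqx_gt0 (R : realType) (N M : nat) (z : 'rV[R]_(N + M)) :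
  0 < sqx z -> \forall z' \near z, 0 < sqx z'.
Proof.
by move=> z0; exact: (cvgr_gt _ (@continuous_sqx R N M z) _ z0).
Qed.

Lemma norm_le_sqx_sqy (R : realType) (N M : nat) (c z : 'rV[R]_(N + M)) :
  `|z| <= `|c| + 1 + sqx z + sqy c z.
Proof.
have le1sq (t : R) : `|t| <= 1 + t ^+ 2.
  rewrite -[t ^+ 2]real_normK ?num_real//; have := sqr_ge0 (`|t| - 1); nra.
have cn (i : 'I_1) k : `|c i k| <= `|c|.
  rewrite [leRHS]/Num.norm/= mx_normrE.
  by apply/bigmax_geP; right => /=; exists (i, k).
rewrite [leLHS]/Num.norm/= mx_normrE; apply/bigmax_leP; split => /=.
  by rewrite !addr_ge0 ?sqx_ge0 ?sqy_ge0.
move=> [i k] _ /=; rewrite ord1 -(splitK k) /unsplit.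
have := sqx_ge0 z; have := sqy_ge0 c z; have := normr_ge0 c.
case: (fintype.split k) => l.
  have := coord_sqr_le_sqx z l.
  have := le1sq (z ord0 (lshift M l)); lra.
have := coord_sqr_le_sqy c z l.
have := le1sq (z ord0 (rshift N l) - c ord0 (rshift N l)).
have := cn ord0 (rshift N l).
have := ler_normD (z ord0 (rshift N l) - c ord0 (rshift N l))
  (c ord0 (rshift N l)).
rewrite subrK; lra.
Qed.

(** The absolute value is needed: a real power is 1 at negative arguments, so
    it is discontinuous at 0. *)
Lemma continuous_norm_powR (R : realType) (a : R) : 0 < a ->
  continuous (fun t : R => `|t| `^ a).
Proof.
move=> a0 t; have [->|t0] := eqVneq t 0; last first.
  apply: (@continuous_comp _ _ _ (fun t : R => `|t|) (fun t => t `^ a)).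
    exact: norm_continuous.
  apply: differentiable_continuous; apply/derivable1_diffP.
  by have [] := der_pow a (_ : 0 < `|t|); rewrite ?normr_gt0.
rewrite /continuous_at normr0 powR0 ?gt_eqF//.
apply/cvgrPdist_lt => e e0; near=> s.
rewrite sub0r normrN ger0_norm ?powR_ge0//.
have -> : e = (e `^ a^-1) `^ a by rewrite -powRrM mulVf ?gt_eqF// powRr1// ltW.
rewrite gt0_ltr_powR ?nnegrE ?powR_ge0//.
near: s; apply/nbhs_ballP; exists (e `^ a^-1); first exact: powR_gt0.
by move=> s /=; rewrite sub0r normrN.
Unshelve. all: by end_near. Qed.

Lemma continuous_sqx_powR (R : realType) (N M : nat) (a : R) : 0 < a ->
  continuous (fun z : 'rV[R]_(N + M) => sqx z `^ a).
Proof.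
move=> a0 z.
have -> : (fun z : 'rV[R]_(N + M) => sqx z `^ a) =
          (fun t : R => `|t| `^ a) \o (@sqx R N M).
  by apply/funext => z' /=; rewrite ger0_norm ?sqx_ge0.
apply: continuous_comp; first exact: continuous_sqx.
exact: continuous_norm_powR.
Qed.

Lemma continuous_at_sqx_powR (R : realType) (N M : nat) (a : R)
    (z : 'rV[R]_(N + M)) : 0 < sqx z ->
  {for z, continuous (fun z' : 'rV[R]_(N + M) => sqx z' `^ a)}.
Proof.
move=> z0; apply: (@continuous_comp _ _ _ (@sqx R N M) (fun t => t `^ a)).
  exact: continuous_sqx.
apply: differentiable_continuous; apply/derivable1_diffP.
by have [] := der_pow a z0.
Qed.

(** * The singular solution and the quotient by it *)

(** The singular solution decays like |x|^2 to the power - decay p. *)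
Definition decay (R : realType) (p : R) : R := (p - 1)^-1.

(** The (p - 1)-st power of [L_const N p].  The Laplacian of the singular
    solution is - ell / |x|^2 times that solution. *)
Definition ell (R : realType) (N : nat) (p : R) : R :=
  2 * decay p * (N%:R - 2 - 2 * decay p).

(** The singular solution as a function of q = |x|^2. *)
Definition sing (R : realType) (N : nat) (p q : R) : R :=
  L_const N p * q `^ (- decay p).

(** The quotient of [u] by the singular solution, written as a product so that
    it is defined, continuous and zero on the axis x = 0. *)
Definition ratio (R : realType) (N M : nat) (p : R) (u : 'rV[R]_(N + M) -> R)
    (z : 'rV[R]_(N + M)) : R := u z * sqx z `^ decay p / L_const N p.

Definition subsingular (R : realType) (N M : nat) (p : R)
    (u : 'rV[R]_(N + M) -> R) : Prop :=
  [/\ class_C 2 u,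
      forall z, laplacian u z + `|u z| `^ (p - 1) * u z = 0 &
      forall z, 0 < sqx z -> `|u z| <= sing N p (sqx z)].

Section Exponents.
Context (R : realType) (N : nat) (p : R).
Hypotheses (hN : (3 <= N)%N) (hp : p_sg R N < p).

Lemma N_ge3 : 3 <= N%:R :> R.
Proof. by rewrite ler_nat. Qed.

Lemma p_gt1 : 1 < p.
Proof.
apply: le_lt_trans hp; rewrite /p_sg ler_pdivlMr; have := N_ge3; lra.
Qed.

Lemma decay_gt0 : 0 < decay p.
Proof. by rewrite invr_gt0; have := p_gt1; lra. Qed.

Lemma decayE : decay p * (p - 1) = 1.
Proof. by rewrite mulVf//; have := p_gt1; lra. Qed.

Lemma decay_lt : 2 * decay p < N%:R - 2.
Proof.
have := N_ge3; have := decay_gt0; have := decayE.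
move: hp; rewrite /p_sg ltr_pdivrMr; last by have := N_ge3; lra.
nra.
Qed.

Lemma ell_gt0 : 0 < ell N p.
Proof.
rewrite /ell !mulr_gt0 ?decay_gt0//; have := decay_lt; lra.
Qed.

Lemma L_constE : L_const N p = ell N p `^ decay p.
Proof. by rewrite /L_const /ell /decay div1r. Qed.

Lemma L_const_gt0 : 0 < L_const N p.
Proof. by rewrite L_constE powR_gt0// ell_gt0. Qed.

Lemma sing_gt0 q : 0 < q -> 0 < sing N p q.
Proof. by move=> q0; rewrite /sing mulr_gt0 ?L_const_gt0 ?powR_gt0. Qed.

Lemma sing_powR q : 0 < q -> sing N p q `^ (p - 1) = ell N p / q.
Proof.
move=> q0; rewrite /sing powRM ?powR_ge0 ?ltW ?L_const_gt0//.
rewrite L_constE -!powRrM mulNr decayE powRr1 ?ltW ?ell_gt0//.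
by rewrite powR_inv1// ltW.
Qed.

End Exponents.

Section Ratio.
Context (R : realType) (N M : nat) (p : R) (u : 'rV[R]_(N + M) -> R).
Hypotheses (hN : (3 <= N)%N) (hp : p_sg R N < p) (su : subsingular p u).

Let L0 : L_const N p != 0.
Proof. by rewrite gt_eqF// L_const_gt0. Qed.

Lemma ratioE z : 0 < sqx z -> u z = sing N p (sqx z) * ratio p u z.
Proof.
move=> z0; rewrite /sing /ratio powRN; field.
by rewrite L0 gt_eqF// powR_gt0.
Qed.

Lemma ratio_axis z : sqx z = 0 -> ratio p u z = 0.
Proof.
by move=> z0; rewrite /ratio z0 powR0 ?gt_eqF ?(decay_gt0 hN hp)// mulr0 mul0r.
Qed.

Lemma ratio_norm_le1 z : `|ratio p u z| <= 1.
Proof.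
have [z0|] := ltP 0 (sqx z); last first.
  rewrite le_eqVlt ltNge sqx_ge0 orbF => /eqP /ratio_axis ->.
  by rewrite normr0.
have [_ _ /(_ z z0)] := su.
rewrite {1}ratioE// normrM gtr0_norm ?sing_gt0//.
by rewrite ger_pMr ?sing_gt0.
Qed.

Lemma continuous_ratio : continuous (ratio p u).
Proof.
have [[cu _] _ _] := su.
move=> z.
have cq := @continuous_sqx_powR R N M _ (decay_gt0 hN hp) z.
exact: (continuousM (continuousM (cu z) cq) (@cst_continuous _ _ _ z)).
Qed.

Lemma laplacian_ratio z : 0 < sqx z ->
  laplacian u z = - (sing N p (sqx z) / sqx z *
    (ell N p * (`|ratio p u z| `^ (p - 1) * ratio p u z))).
Proof.
move=> z0; have [_ /(_ z) + _] := su.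
move=> /eqP; rewrite addr_eq0 => /eqP ->; congr (- _).
rewrite {1 2}ratioE// normrM gtr0_norm ?sing_gt0// powRM ?normr_ge0//; last first.
  by rewrite ltW// sing_gt0.
by rewrite sing_powR//; ring.
Qed.

End Ratio.

(** * A barrier forcing the quotient to be nonpositive *)

Lemma exists_global_max (R : realType) (n : nat) (F : 'rV[R]_n -> R)
    (z0 : 'rV[R]_n) (r : R) :
  continuous F -> 0 < F z0 -> (forall z, r < `|z| -> F z <= 0) ->
  exists z, forall z', F z' <= F z.
Proof.
move=> cF F0 Fout.
pose K := [set z : 'rV[R]_n | `|z| <= r].
have Kz0 : K z0 by rewrite /K/= leNgt; apply/negP => /Fout; rewrite leNgt F0.
have cK : compact K.
  apply: bounded_closed_compact.
    exists r; split; first exact: num_real.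
    by move=> x rx z /le_trans; apply; exact: ltW.
  by apply: closed_comp (@closed_le _ r) => z _; exact: norm_continuous.
have [|z _ zmax] := @EVT_max_rV _ _ F K (ex_intro _ _ Kz0) cK.
  exact: continuous_subspaceT.
exists z => z'; have [z'r|/Fout Fz'] := leP `|z'| r.
  by apply: zmax; rewrite inE.
by rewrite (le_trans Fz')// (le_trans (ltW F0))// zmax// inE.
Qed.

(** Maximize v - psi, with psi = T |y - y0|^2 + K (T |x|^2)^k, and let m be the
    maximum.  If m > 0 then phi (m + psi) touches u from above, and
    in the touching inequality the gain K (c - 2k (2k - b)) (T |x|^2)^k beats
    the only bad term 2 M T |x|^2, which comes from the y-derivatives.
    The scale T is tuned so that psi(z0) = v(z0) / 2. *)
Lemma ratio_le0_barrier (R : realType) (N M : nat) (p : R)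
    (u : 'rV[R]_(N + M) -> R) (k c : R) (z0 : 'rV[R]_(N + M)) :
  (3 <= N)%N -> p_sg R N < p -> subsingular p u ->
  0 < k -> k <= 1 -> 0 <= c ->
  2 * k * (2 * k - (4 * decay p - N%:R + 2)) < c ->
  (forall z, 0 < sqx z -> 0 < ratio p u z ->
     c * ratio p u z <=
     ell N p * (ratio p u z - `|ratio p u z| `^ (p - 1) * ratio p u z)) ->
  0 < sqx z0 -> ratio p u z0 <= 0.
Proof.
move=> hN hp su k0 k1 c0; set g := 2 * k * _ => gc hc q0; rewrite leNgt.
set v := ratio p u; apply/negP => v0.
have L0 := L_const_gt0 hN hp; set L := L_const N p in L0.
(* K makes the gain (c - g) K exceed 2 M, and is at least 1. *)
pose K := (2 * M%:R + 1) / (c - g) + 1.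
have M0 : 0 <= M%:R :> R by [].
have K1 : 1 <= K.
  by rewrite /K lerDr divr_ge0//; lra.
have Kcg : 2 * M%:R + 1 <= K * (c - g).
  have -> : K * (c - g) = 2 * M%:R + 1 + (c - g).
    by rewrite /K; field; rewrite subr_eq0 gt_eqF.
  by lra.
pose T := (v z0 / (2 * K)) `^ k^-1 / sqx z0.
have T0 : 0 < T by rewrite divr_gt0// powR_gt0// divr_gt0//; lra.
have Tz0 : (T * sqx z0) `^ k = v z0 / (2 * K).
  rewrite /T divfK ?gt_eqF// -powRrM mulVf ?gt_eqF// powRr1//.
  by rewrite divr_ge0//; lra.
pose psi (z : 'rV[R]_(N + M)) := T * sqy z0 z + K * (T `^ k * sqx z `^ k).
have psiX (z : 'rV[R]_(N + M)) : T `^ k * sqx z `^ k = (T * sqx z) `^ k.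
  by rewrite powRM ?sqx_ge0// ltW.
have cF : continuous (fun z => v z - psi z).
  move=> z; have cv := @continuous_ratio R N M p u hN hp su z.
  have cq := @continuous_sqx_powR R N M k k0 z.
  have cs := @continuous_sqy R N M z0 z.
  have cc (a : R) := @cst_continuous 'rV[R]_(N + M) R a z.
  exact: (continuousB cv (continuousD (continuousM (cc T) cs)
    (continuousM (cc K) (continuousM (cc (T `^ k)) cq)))).
have Fz0 : 0 < v z0 - psi z0.
  rewrite /psi sqy_center mulr0 add0r psiX Tz0.
  have -> : v z0 - K * (v z0 / (2 * K)) = v z0 / 2 by field; lra.
  by lra.
have out (z : 'rV[R]_(N + M)) : 1 <= psi z -> v z - psi z <= 0.
  have := ratio_norm_le1 hN hp su z; rewrite ler_norml -/(v z); lra.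
have KX_ge0 (z : 'rV[R]_(N + M)) : 0 <= K * (T * sqx z) `^ k.
  by rewrite mulr_ge0 ?powR_ge0//; lra.
have TS_ge0 (z : 'rV[R]_(N + M)) : 0 <= T * sqy z0 z by rewrite mulr_ge0 ?sqy_ge0// ltW.
have far (z : 'rV[R]_(N + M)) : `|z0| + 1 + T^-1 + T^-1 < `|z| -> v z - psi z <= 0.
  move=> hz; apply: out; rewrite /psi psiX leNgt; apply/negP => psi1.
  have := norm_le_sqx_sqy z0 z.
  have : sqy z0 z <= T^-1.
    rewrite -[leRHS]mul1r ler_pdivlMr// mulrC.
    have := KX_ge0 z; lra.
  have : sqx z <= T^-1.
    rewrite -[leRHS]mul1r ler_pdivlMr// mulrC leNgt; apply/negP => TQ1.
    have : 1 <= (T * sqx z) `^ k.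
      by rewrite -[leLHS](powRr0 (T * sqx z)) ler_powR ?ltW.
    have := TS_ge0 z; nra.
  lra.
have [z zmax] := exists_global_max cF Fz0 far.
pose m := v z - psi z.
have m0 : 0 < m by apply: lt_le_trans Fz0 (zmax z0).
have psi1 : psi z < 1.
  by rewrite ltNge; apply/negP => /out; rewrite leNgt -/m m0.
have Q0 : 0 < sqx z.
  rewrite lt_neqAle sqx_ge0 andbT; apply/eqP => Qz.
  move: m0; rewrite /m /v ratio_axis// /psi psiX.
  have := KX_ge0 z; have := TS_ge0 z; lra.
set Q := sqx z in Q0 *.
pose sg := decay p.
pose A (t : R) := L * (m * t `^ (- sg) + K * T `^ k * t `^ (k - sg)).
pose A1 (t : R) := L * (m * (- sg * (t `^ (- sg) / t)) +
  K * T `^ k * ((k - sg) * (t `^ (k - sg) / t))).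
pose A2 (t : R) := L * (m * (- sg * ((- sg - 1) * (t `^ (- sg) / t / t))) +
  K * T `^ k * ((k - sg) * ((k - sg - 1) * (t `^ (k - sg) / t / t)))).
pose G (t : R) := L * T * t `^ (- sg).
pose G1 (t : R) := L * T * (- sg * (t `^ (- sg) / t)).
pose G2 (t : R) := L * T * (- sg * ((- sg - 1) * (t `^ (- sg) / t / t))).
have dA (t : R) : 0 < t -> is_derive (t : R) 1 A (A1 t).
  move=> t0; exact: (derZ L (derD (derZ m (der_pow (- sg) t0))
    (derZ (K * T `^ k) (der_pow (k - sg) t0)))).
have dA1 (t : R) : 0 < t -> is_derive (t : R) 1 A1 (A2 t).
  move=> t0; exact: (derZ L (derD (derZ m (derZ _ (der_powdiv (- sg) t0)))
    (derZ (K * T `^ k) (derZ _ (der_powdiv (k - sg) t0))))).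
have dG (t : R) : 0 < t -> is_derive (t : R) 1 G (G1 t).
  by move=> t0; exact: (derZ _ (der_pow (- sg) t0)).
have dG1 (t : R) : 0 < t -> is_derive (t : R) 1 G1 (G2 t).
  by move=> t0; exact: (derZ _ (derZ _ (der_powdiv (- sg) t0))).
have dP (t : R) : is_derive (t : R) 1 (fun s : R => s) ((fun=> 1) t).
  exact: is_derive_id.
have dP1 (t : R) : is_derive (t : R) 1 (fun=> 1 : R) ((fun=> 0) t).
  exact: derC.
have touchE (z' : 'rV[R]_(N + M)) : 0 < sqx z' ->
    A (sqx z') + G (sqx z') * sqy z0 z' = sing N p (sqx z') * (m + psi z').
  move=> z'0; rewrite /A /G /sing -/L -/sg /psi powRD; last first.
    by rewrite (gt_eqF z'0) implybT.
  by ring.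
have le_u : \forall z' \near z,
    u z' <= A (sqx z') + G (sqx z') * (fun s : R => s) (sqy z0 z').
  near=> z'.
  have z'0 : 0 < sqx z'.
    by near: z'; exact: near_sqx_gt0.
  rewrite touchE// {1}(ratioE u hN hp)// ler_pM2l ?sing_gt0//.
  by have := zmax z'; rewrite -/m -/(v z') /=; lra.
have eq_u : u z = A Q + G Q * (fun s : R => s) (sqy z0 z).
  rewrite touchE// {1}(ratioE u hN hp)//; congr (_ * _); rewrite /m.
  by rewrite -/v; ring.
have [C2 _ _] := su.
have := laplacian_le_of_touching C2 Q0 dA dA1 dG dG1 dP dP1 le_u eq_u.
rewrite -/Q (laplacian_ratio hN hp su)// -/Q.
set fv := `|_| `^ _ * _.
have vz : v z = m + T * sqy z0 z + K * (T * Q) `^ k.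
  by rewrite /m /psi psiX -/Q; ring.
have hfv : c * v z <= ell N p * (v z - fv).
  apply: hc => //; rewrite -/v vz.
  by have := KX_ge0 z; have := TS_ge0 z; rewrite -/Q; lra.
set X := (T * Q) `^ k in vz.
have QX : Q `^ (k - sg) = Q `^ k * Q `^ (- sg).
  by rewrite powRD//; apply/implyP => _; rewrite gt_eqF.
set rhs := (X in _ <= X).
have -> : rhs = L * Q `^ (- sg) / Q * (- ell N p * m +
    K * X * (g - ell N p) - ell N p * T * sqy z0 z + 2 * M%:R * (T * Q)).
  rewrite /rhs /A1 /A2 /G1 /G2 /G QX /X powRM ?ltW// /ell /g -/sg.
  by field; rewrite gt_eqF.
have pref_gt0 : 0 < L * Q `^ (- sg) / Q.
  by apply: divr_gt0 => //; apply: mulr_gt0 => //; exact: powR_gt0.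
rewrite /sing -/L -/sg -mulrN ler_pM2l//.
(* psi < 1 at the maximum, so T Q <= 1 and T Q is at most its k-th power. *)
have TQ1 : T * Q <= 1.
  rewrite leNgt; apply/negP => TQ1.
  have : 1 <= X.
    by rewrite -[leLHS](powRr0 (T * Q)) ler_powR ?ltW.
  by move: psi1; rewrite /psi psiX -/Q -/X; have := TS_ge0 z; nra.
have TQX : T * Q <= X.
  by apply: ger1_powR => //; rewrite mulr_gt0.
have X0 : 0 < X by rewrite powR_gt0// mulr_gt0.
have := TS_ge0 z => S0 lap.
have h1 : c * (K * X) <= c * v z by rewrite ler_wpM2l// vz; lra.
have h2 : M%:R * (T * Q) <= M%:R * X by rewrite ler_wpM2l.
have h3 : (2 * M%:R + 1) * X <= K * (c - g) * X by rewrite ler_wpM2r// ltW.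
have h4 : ell N p * v z = ell N p * m + ell N p * T * sqy z0 z + ell N p * (K * X).
  by rewrite vz; ring.
move: hfv; rewrite mulrBr h4 => hfv.
by move: lap hfv h1 h2 h3; lra.
Unshelve. all: by end_near. Qed.

(** * The quotient stays strictly below one *)

Lemma norm_sub_axis_lt (R : realType) (N M : nat) (c z : 'rV[R]_(N + M))
    (r : R) :
  sqx c = 0 -> 0 < r -> sqx z + sqy c z < r ^+ 2 -> `|c - z| < r.
Proof.
move=> c0 r0 hr.
have lt_sq (t : R) : t ^+ 2 < r ^+ 2 -> `|t| < r.
  by move=> h; rewrite -(ltr_pXn2r (_ : 0 < 2)%N)// ?nnegrE ?ltW// real_normK ?num_real.
rewrite [ltLHS]/Num.norm/= mx_normrE; apply/bigmax_ltP; split => //=.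
move=> [i k] _ /=; rewrite ord1 !mxE -(splitK k) /unsplit.
apply: lt_sq; apply: le_lt_trans hr.
have := sqx_ge0 z; have := sqy_ge0 c z.
case: (fintype.split k) => l.
  rewrite (sqx_eq0_coord l c0) sub0r sqrrN.
  by have := coord_sqr_le_sqx z l; lra.
have := coord_sqr_le_sqy c z l.
by rewrite -(sqrrN (c _ _ - _)) opprB; lra.
Qed.

Lemma powR_mul_le1 (R : realType) (a x : R) :
  0 <= a -> `|x| <= 1 -> `|x| `^ a * x <= 1.
Proof.
move=> a0 x1.
have h : `|x| `^ a <= 1.
  have := @ge0_ler_powR R a a0 `|x| 1.
  by rewrite !nnegrE powR1; apply.
apply: le_trans (ler_norm _) _; rewrite normrM ger0_norm ?powR_ge0//.
by rewrite mulr_ile1 ?powR_ge0.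
Qed.

(** Strong maximum principle.  Let c be the projection of z1 to the axis.  If
    v(z1) = 1, the function
    E = exp(- lam |z - c|^2) - exp(- lam (|z1 - c|^2 + 1)) is positive at z1,
    so v - 1 + |x|^(2 sg) E / 2 has a positive maximum.  It is not attained near
    c, where v < 1/2, and away from c the Gaussian is strictly subharmonic for
    lam large.  There phi (1 + m) - L E / 2 touches u from above with a
    Laplacian below - ell phi / |x|^2, although the Laplacian of u is at
    least - ell phi / |x|^2 because v <= 1. *)
Lemma ratio_lt1 (R : realType) (N M : nat) (p : R)
    (u : 'rV[R]_(N + M) -> R) (z1 : 'rV[R]_(N + M)) :
  (3 <= N)%N -> p_sg R N < p -> subsingular p u ->
  0 < sqx z1 -> ratio p u z1 < 1.
Proof.
move=> hN hp su Q10; rewrite ltNge; apply/negP => v1.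
have L0 := L_const_gt0 hN hp; set L := L_const N p in L0.
have sg0 := decay_gt0 hN hp; set sg := decay p in sg0.
pose v := ratio p u; rewrite -/(v z1) in v1.
pose c : 'rV[R]_(N + M) := row_mx 0 (rsubmx z1).
have c0 : sqx c = 0.
  by rewrite /sqx big1// => i _; rewrite /c row_mxEl mxE expr0n.
have sqyc (z : 'rV[R]_(N + M)) : sqy c z = sqy z1 z.
  by rewrite /sqy; apply: eq_bigr => j _; rewrite /c row_mxEr mxE.
have /nbhs_ballP[r /= r0 hr] : \forall z \near c, v z < 1 / 2.
  have cv := @continuous_ratio R N M p u hN hp su c.
  apply: (cvgr_lt _ cv); rewrite ratio_axis//; lra.
pose rho := Num.min 1 (r ^+ 2).
have rho0 : 0 < rho by rewrite lt_min ltr01 exprn_gt0.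
have core (z : 'rV[R]_(N + M)) : sqx z + sqy z1 z < rho -> v z < 1 / 2 /\ sqx z < 1.
  rewrite lt_min => /andP[h1 h2]; split; last first.
    by have := sqy_ge0 z1 z; lra.
  apply: hr; rewrite -ball_normE/=; apply: norm_sub_axis_lt => //.
  by rewrite sqyc.
(* Beyond |z - c|^2 = rho the Gaussian with this parameter is subharmonic. *)
pose lam := (N%:R + M%:R + 1) / rho.
have N0 := N_ge3 R hN; have M0 : 0 <= M%:R :> R by [].
have lam0 : 0 < lam by rewrite divr_gt0//; lra.
pose E0 := expR (- lam * (sqx z1 + 1)).
pose E (z : 'rV[R]_(N + M)) :=
  expR (- lam * sqx z) * expR (- lam * sqy z1 z) - E0.
pose F (z : 'rV[R]_(N + M)) := v z - 1 + 1 / 2 * (sqx z `^ sg * E z).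
have cF : continuous F.
  move=> z; have cv := @continuous_ratio R N M p u hN hp su z.
  have cq := @continuous_sqx_powR R N M sg sg0 z.
  have cc (a : R) := @cst_continuous 'rV[R]_(N + M) R a z.
  have ce f : {for z, continuous f} ->
      {for z, continuous (fun z' => expR (- lam * f z'))}.
    move=> cf; apply: (@continuous_comp _ _ _ (fun z' => - lam * f z') expR).
      exact: (continuousM (cc (- lam)) cf).
    exact: continuous_expR.
  have cE := continuousB (continuousM (ce _ (@continuous_sqx R N M z))
    (ce _ (@continuous_sqy R N M z1 z))) (cc E0).
  exact: (continuousD (continuousB cv (cc 1))
    (continuousM (cc (1 / 2)) (continuousM cq cE))).
have v_le1 (z : 'rV[R]_(N + M)) : v z <= 1.
  by have := ratio_norm_le1 hN hp su z; rewrite ler_norml => /andP[].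
have F_gt0 (z : 'rV[R]_(N + M)) : 0 < F z -> 0 < sqx z /\ 0 < E z.
  move=> Fz; have Qz : 0 < sqx z.
    rewrite lt_neqAle sqx_ge0 andbT; apply/eqP => Qz.
    move: Fz; rewrite /F /v ratio_axis// -Qz powR0 ?gt_eqF//; lra.
  split=> //; rewrite ltNge; apply/negP => Ez.
  have : sqx z `^ sg * E z <= 0 by rewrite mulr_ge0_le0 ?powR_ge0.
  by move: Fz (v_le1 z); rewrite /F; lra.
have E_gt0 (z : 'rV[R]_(N + M)) : 0 < E z -> sqx z + sqy z1 z < sqx z1 + 1.
  rewrite /E /E0 -expRD subr_gt0 ltr_expR -mulrDr !mulNr ltrN2.
  by rewrite ltr_pM2l.
have Fz1 : 0 < F z1.
  have Ez1 : 0 < E z1.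
    rewrite /E /E0 sqy_center mulr0 expR0 mulr1 subr_gt0 ltr_expR.
    by rewrite !mulNr ltrN2 ltr_pM2l// ltrDl.
  have : 0 < sqx z1 `^ sg * E z1 by rewrite mulr_gt0 ?powR_gt0.
  by move: v1; rewrite /F; lra.
have far (z : 'rV[R]_(N + M)) : `|z1| + 1 + (sqx z1 + 1) + (sqx z1 + 1) < `|z| -> F z <= 0.
  move=> hz; rewrite leNgt; apply/negP => /F_gt0[_ /E_gt0].
  have := norm_le_sqx_sqy z1 z.
  by have := sqx_ge0 z; have := sqy_ge0 z1 z; lra.
have [z zmax] := exists_global_max cF Fz1 far.
pose m := F z.
have m0 : 0 < m by apply: lt_le_trans Fz1 (zmax z1).
have [Q0 Ez] := F_gt0 z m0.
have rhoz : rho <= sqx z + sqy z1 z.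
  rewrite leNgt; apply/negP => /core[v12 Q1].
  have : sqx z `^ sg * E z <= 1.
    rewrite mulr_ile1 ?powR_ge0 ?(ltW Ez)//.
      have := @ge0_ler_powR R sg (ltW sg0) (sqx z) 1.
      by rewrite !nnegrE powR1; apply => //; rewrite ?sqx_ge0 ?ltW.
    rewrite /E -expRD -mulrDr mulNr.
    have : expR (- (lam * (sqx z + sqy z1 z))) < 1.
      rewrite -[ltRHS]expR0 ltr_expR oppr_lt0 mulr_gt0//.
      by have := sqy_ge0 z1 z; lra.
    by have := expR_gt0 (- lam * (sqx z1 + 1)); rewrite -/E0; lra.
  by move: m0; rewrite /m /F; lra.
set Q := sqx z in Q0 rhoz *; set S := sqy z1 z in rhoz *.
pose A (t : R) := L * (1 + m) * t `^ (- sg) + 1 / 2 * L * E0.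
pose A1 (t : R) := L * (1 + m) * (- sg * (t `^ (- sg) / t)) + 0.
pose A2 (t : R) :=
  L * (1 + m) * (- sg * ((- sg - 1) * (t `^ (- sg) / t / t))) + 0.
pose P (t : R) := expR (- lam * t).
pose P1 (t : R) := - lam * expR (- lam * t).
pose P2 (t : R) := - lam * (- lam * expR (- lam * t)).
have dA (t : R) : 0 < t -> is_derive (t : R) 1 A (A1 t).
  by move=> t0; exact: (derD (derZ _ (der_pow (- sg) t0)) (derC _ _)).
have dA1 (t : R) : 0 < t -> is_derive (t : R) 1 A1 (A2 t).
  move=> t0.
  exact: (derD (derZ _ (derZ _ (der_powdiv (- sg) t0))) (derC _ _)).
have dP (t : R) : is_derive (t : R) 1 P (P1 t) by exact: der_expR.
have dP1 (t : R) : is_derive (t : R) 1 P1 (P2 t).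
  by exact: (derZ _ (der_expR _ _)).
pose G (t : R) := - (1 / 2 * L) * P t.
pose G1 (t : R) := - (1 / 2 * L) * P1 t.
pose G2 (t : R) := - (1 / 2 * L) * P2 t.
have dG (t : R) : 0 < t -> is_derive (t : R) 1 G (G1 t).
  by move=> _; exact: (derZ _ (dP t)).
have dG1 (t : R) : 0 < t -> is_derive (t : R) 1 G1 (G2 t).
  by move=> _; exact: (derZ _ (dP1 t)).
have touchE (z' : 'rV[R]_(N + M)) : 0 < sqx z' ->
    A (sqx z') + G (sqx z') * P (sqy z1 z') =
    sing N p (sqx z') * (1 + m - 1 / 2 * (sqx z' `^ sg * E z')).
  move=> z'0; rewrite /A /G /P /sing -/L -/sg /E powRN.
  by field; rewrite gt_eqF// powR_gt0.
have le_u : \forall z' \near z,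
    u z' <= A (sqx z') + G (sqx z') * P (sqy z1 z').
  near=> z'.
  have z'0 : 0 < sqx z' by near: z'; exact: near_sqx_gt0.
  rewrite touchE// {1}(ratioE u hN hp)// ler_pM2l ?sing_gt0//.
  by have := zmax z'; rewrite -/m /F -/(v z') /=; lra.
have eq_u : u z = A Q + G Q * P S.
  rewrite touchE// {1}(ratioE u hN hp)//; congr (_ * _); rewrite /m /F -/(v z).
  by ring.
have [C2 _ _] := su.
have := laplacian_le_of_touching C2 Q0 dA dA1 dG dG1 dP dP1 le_u eq_u.
rewrite -/Q -/S (laplacian_ratio hN hp su)// -/Q.
set fv := `|_| `^ _ * _.
have fv1 : fv <= 1.
  apply: powR_mul_le1; last exact: ratio_norm_le1 hN hp su z.
  by have := p_gt1 hN hp; lra.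
set rhs := (X in _ <= X).
have -> : rhs = - (L * Q `^ (- sg) / Q) * (ell N p * (1 + m)) -
    1 / 2 * L * P Q * P S * (2 * lam) *
      (2 * lam * (Q + S) - (N%:R + M%:R)).
  rewrite /rhs /A1 /A2 /G1 /G2 /P2 /P1 -/(P Q) -/(P S) /ell -/sg /G.
  by field; rewrite gt_eqF.
have pref_gt0 : 0 < L * Q `^ (- sg) / Q.
  by apply: divr_gt0 => //; apply: mulr_gt0 => //; exact: powR_gt0.
rewrite /sing -/L -/sg.
have h1 : 0 < 2 * lam * (Q + S) - (N%:R + M%:R).
  have : lam * rho <= lam * (Q + S) by rewrite ler_pM2l.
  by rewrite {1}/lam divfK ?gt_eqF//; lra.
have h2 : 0 < 1 / 2 * L * P Q * P S * (2 * lam) *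
    (2 * lam * (Q + S) - (N%:R + M%:R)).
  rewrite mulr_gt0// mulr_gt0//; last by lra.
  by rewrite !mulr_gt0 ?expR_gt0//; lra.
have h3 : L * Q `^ (- sg) / Q * (ell N p * fv) <=
    L * Q `^ (- sg) / Q * (ell N p * (1 + m)).
  by rewrite ler_pM2l// ler_pM2l ?ell_gt0//; lra.
by move: h2 h3; rewrite mulNr; lra.
Unshelve. all: by end_near. Qed.

(** * A compactly supported bump for the Hardy operator *)

Lemma der_powM (R : realType) (a : R) (B : R -> R) (x b : R) : 0 < x ->
  is_derive (x : R) 1 B (b / x) ->
  is_derive (x : R) 1 (fun t : R => t `^ a * B t : R)
    (x `^ a / x * (b + a * B x) : R).
Proof.
move=> x0 dB; apply: (is_derive_eq (derM (der_pow a x0) dB)).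
by field; rewrite gt_eqF.
Qed.

Lemma der_powdivM (R : realType) (a : R) (B : R -> R) (x b : R) : 0 < x ->
  is_derive (x : R) 1 B (b / x) ->
  is_derive (x : R) 1 (fun t : R => t `^ a / t * B t : R)
    (x `^ a / x / x * (b + (a - 1) * B x) : R).
Proof.
move=> x0 dB; apply: (is_derive_eq (derM (der_powdiv a x0) dB)).
by field; rewrite gt_eqF.
Qed.

(** With t = r^2 and a = r0^(2e) these are 2 cosh(2e log(r / r0)) and
    2 sinh(2e log(r / r0)).  They replace the more usual trigonometric functions
    of log r: being combinations of two powers, they are exchanged by the Euler
    derivative t d/dt up to the factor e. *)
Definition coshlog (R : realType) (e a t : R) : R :=
  a^-1 * t `^ e + a * t `^ (- e).

Definition sinhlog (R : realType) (e a t : R) : R :=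
  a^-1 * t `^ e + - a * t `^ (- e).

Lemma der_coshlog (R : realType) (e a x : R) : 0 < x ->
  is_derive (x : R) 1 (coshlog e a) (e * sinhlog e a x / x : R).
Proof.
move=> x0; rewrite /coshlog.
apply: (is_derive_eq (derD (derZ _ (der_pow e x0)) (derZ _ (der_pow (- e) x0)))).
by rewrite /sinhlog; ring.
Qed.

Lemma der_sinhlog (R : realType) (e a x : R) : 0 < x ->
  is_derive (x : R) 1 (sinhlog e a) (e * coshlog e a x / x : R).
Proof.
move=> x0; rewrite /sinhlog.
apply: (is_derive_eq (derD (derZ _ (der_pow e x0)) (derZ _ (der_pow (- e) x0)))).
by rewrite /coshlog; ring.
Qed.

Lemma sinhlog_sqr (R : realType) (e a x : R) : 0 < x -> a != 0 ->
  sinhlog e a x ^+ 2 = coshlog e a x ^+ 2 - 4.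
Proof.
move=> x0 a0; rewrite /coshlog /sinhlog powRN; field.
by rewrite a0 gt_eqF// powR_gt0.
Qed.

(** Used only on the compact interval of positive t where [coshlog] is at
    most 4, at whose ends it vanishes; [bump1] and [bump2] are its first and
    second Euler derivatives. *)
Definition bump (R : realType) (e a t : R) : R := (4 - coshlog e a t) ^+ 2.

Definition bump1 (R : realType) (e a t : R) : R :=
  - 2 * e * (sinhlog e a t * (4 - coshlog e a t)).

Definition bump2 (R : realType) (e a t : R) : R :=
  - 2 * e * (e * coshlog e a t * (4 - coshlog e a t) -
             e * sinhlog e a t ^+ 2).

Lemma der_bump (R : realType) (e a x : R) : 0 < x ->
  is_derive (x : R) 1 (bump e a) (bump1 e a x / x : R).
Proof.
move=> x0.
have d4 := derD (derC 4 x) (derZ (-1) (der_coshlog e a x0)).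
have dB := derM d4 d4.
have -> : bump e a =
    (fun t => (4 + -1 * coshlog e a t) * (4 + -1 * coshlog e a t)).
  by apply/funext => t; rewrite /bump mulN1r expr2.
apply: (is_derive_eq dB); rewrite /bump1; ring.
Qed.

Lemma der_bump1 (R : realType) (e a x : R) : 0 < x ->
  is_derive (x : R) 1 (bump1 e a) (bump2 e a x / x : R).
Proof.
move=> x0.
have d4 := derD (derC 4 x) (derZ (-1) (der_coshlog e a x0)).
have dB := derZ (- 2 * e) (derM (der_sinhlog e a x0) d4).
have -> : bump1 e a =
    (fun t => - 2 * e * (sinhlog e a t * (4 + -1 * coshlog e a t))).
  by apply/funext => t; rewrite /bump1 mulN1r.
apply: (is_derive_eq dB); rewrite /bump2; ring.
Qed.

(** The square makes the bump convex near the ends of its support, and this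
    pays for the concavity in the middle: the difference of the two sides is
    6 e^2 (coshlog - 2)^2.  The value 4 in [bump] is chosen to get this
    perfect square. *)
Lemma bump2_ge (R : realType) (e a x : R) : 0 < x -> a != 0 ->
  - 2 * e ^+ 2 * bump e a x <= bump2 e a x.
Proof.
move=> x0 a0; rewrite /bump2 sinhlog_sqr// /bump.
set c := coshlog _ _ _; rewrite -subr_ge0.
rewrite (_ : _ - _ = 6 * e ^+ 2 * (c - 2) ^+ 2); last by ring.
apply: mulr_ge0; last exact: sqr_ge0.
by apply: mulr_ge0; [exact: ler0n|exact: sqr_ge0].
Qed.

(** The right side is the Laplacian on R^m of (1 - rho |y|^2)^2, with s = |y|^2.
    The constant (2 + m)^2 / 2 is the least one for which the difference,
    a quadratic in 1 - rho s, is nonnegative. *)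
Lemma transverse_bump_ge (R : realType) (m rho s : R) :
  0 <= m -> 0 <= rho ->
  - (rho * ((2 + m) ^+ 2 / 2)) * (1 - rho * s) ^+ 2 <=
  4 * s * (2 * rho ^+ 2) + 2 * m * (- 2 * rho * (1 - rho * s)).
Proof.
move=> m0 r0; rewrite -subr_ge0; set X := 1 - rho * s.
rewrite (_ : _ - _ = rho * (2^-1 * ((2 + m) * X - 4) ^+ 2)); last first.
  rewrite (_ : 4 * s * (2 * rho ^+ 2) = 8 * rho * (rho * s)); last by ring.
  have -> : rho * s = 1 - X by rewrite /X; ring.
  by field.
apply: mulr_ge0 => //; apply: mulr_ge0; last exact: sqr_ge0.
by rewrite invr_ge0 ler0n.
Qed.

(** * The gap below one *)

(** The graph of v^p has slope close to p near v = 1, so a chord to (1, 1) of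
    slope mu / l < p starts away from 1.  Quantitatively, Young's inequality
    bounds the slope of the chord from below by p v^(p-1). *)
Lemma le_of_chord_slope (R : realType) (p l mu v : R) :
  1 < p -> 0 < l -> v < 1 ->
  l * (1 - `|v| `^ (p - 1) * v) <= mu * (1 - v) ->
  v <= (mu / (p * l)) `^ decay p.
Proof.
move=> p1 l0 v1 h; have [v0|v0] := leP v 0.
  by rewrite (le_trans v0)// powR_ge0.
rewrite (gtr0_norm v0) in h.
set y := v `^ (p - 1) in h.
have y0 : 0 <= y by exact: powR_ge0.
have young : p * y <= (p - 1) * (y * v) + 1.
  have := @conjugate_powR R y 1 (p / (p - 1)) p y0 ler01.
  rewrite powR1 mulr1 /y -powRrM (_ : (p - 1) * (p / (p - 1)) = p); last first.
    by field; lra.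
  rewrite -(@mulr_powRB1 _ v p (ltW v0)); last by lra.
  rewrite -/y [v * y]mulrC => /(_ _ _ _) H.
  have {}H : y <= y * v / (p / (p - 1)) + 1 / p.
    by apply: H; [rewrite divr_gt0; lra|lra|field; lra].
  have : p * y <= p * (y * v / (p / (p - 1)) + 1 / p) by rewrite ler_pM2l//; lra.
  have -> : p * (y * v / (p / (p - 1)) + 1 / p) = (p - 1) * (y * v) + 1.
    by field; lra.
  by [].
have hy : y <= mu / (p * l).
  rewrite ler_pdivlMr; last by rewrite mulr_gt0//; lra.
  have : l * (p * y * (1 - v)) <= l * (1 - y * v) by rewrite ler_pM2l//; lra.
  move=> h2; rewrite -(ler_pM2r (_ : 0 < 1 - v)); last by lra.
  by lra.
have -> : v = y `^ decay p.
  by rewrite /y -powRrM /decay mulfV ?powRr1 ?ltW//; lra.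
apply: ge0_ler_powR => //; rewrite ?nnegrE//.
  by rewrite invr_ge0; lra.
exact: le_trans hy.
Qed.

(** The power - (N - 2) / 4 of |x|^2 is the ground state of the Hardy operator,
    so multiplying by it turns the radial Laplacian into four times the second
    Euler derivative minus (N - 2)^2 / 4, all over |x|^2.  The bump costs
    8 e^2 more, and the cut-off in y costs another e^2 by the choice of rho. *)
Lemma ratio_touching_bump (R : realType) (N M : nat) (p : R)
    (u : 'rV[R]_(N + M) -> R) (e a rho q : R) (z0 z : 'rV[R]_(N + M)) :
  (3 <= N)%N -> p_sg R N < p -> subsingular p u ->
  0 < a -> 0 <= rho -> 0 < q -> 0 < sqx z ->
  rho * ((2 + M%:R) ^+ 2 / 2) * sqx z <= e ^+ 2 ->
  let Psi z' := q * (sqx z' `^ (- ((N%:R - 2) / 4)) * bump e a (sqx z')) *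
                (1 - rho * sqy z0 z') ^+ 2 in
  (\forall z' \near z, u z' <= sing N p (sqx z') - Psi z') ->
  u z = sing N p (sqx z) - Psi z ->
  ell N p * (1 - `|ratio p u z| `^ (p - 1) * ratio p u z) <=
  ((N%:R - 2) ^+ 2 / 4 + 9 * e ^+ 2) * (1 - ratio p u z).
Proof.
move=> hN hp su a0 rho0 q0 Q0 hrho Psi le_u eq_u.
have L0 := L_const_gt0 hN hp; set L := L_const N p in L0.
have sg0 := decay_gt0 hN hp; set sg := decay p in sg0.
pose al : R := - ((N%:R - 2) / 4).
set Q := sqx z in Q0 hrho *; set S := sqy z0 z.
pose A (t : R) := L * t `^ (- sg).
pose A1 (t : R) := L * (- sg * (t `^ (- sg) / t)).
pose A2 (t : R) := L * (- sg * ((- sg - 1) * (t `^ (- sg) / t / t))).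
pose B := bump e a.
pose B1 := bump1 e a.
pose B2 := bump2 e a.
pose G (t : R) := - q * (t `^ al * B t).
pose G1 (t : R) := - q * (t `^ al / t * (B1 t + al * B t)).
pose G2 (t : R) := - q * (t `^ al / t / t *
  (B2 t + al * B1 t + (al - 1) * (B1 t + al * B t))).
pose P (t : R) := (1 + - rho * t) * (1 + - rho * t).
pose P1 (t : R) := - 2 * rho * (1 + - rho * t).
pose P2 (t : R) := 2 * rho ^+ 2.
have dA (t : R) : 0 < t -> is_derive (t : R) 1 A (A1 t).
  by move=> t0; exact: (derZ _ (der_pow (- sg) t0)).
have dA1 (t : R) : 0 < t -> is_derive (t : R) 1 A1 (A2 t).
  by move=> t0; exact: (derZ _ (derZ _ (der_powdiv (- sg) t0))).
have dG (t : R) : 0 < t -> is_derive (t : R) 1 G (G1 t).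
  by move=> t0; exact: (derZ _ (der_powM al t0 (der_bump e a t0))).
have dG1 (t : R) : 0 < t -> is_derive (t : R) 1 G1 (G2 t).
  move=> t0; apply: (derZ _ (der_powdivM al t0 _)).
  apply: (is_derive_eq (derD (der_bump1 e a t0) (derZ al (der_bump e a t0)))).
  by rewrite /B2 /B1; ring.
have dlin (t : R) : is_derive (t : R) 1 (fun t : R => 1 + - rho * t)
    (- rho : R).
  have did : is_derive (t : R) 1 (fun t : R => t) (1 : R) by exact: is_derive_id.
  apply: (is_derive_eq (derD (derC 1 t) (derZ (- rho) did))).
  by rewrite add0r mulr1.
have dP (t : R) : is_derive (t : R) 1 P (P1 t).
  by apply: (is_derive_eq (derM (dlin t) (dlin t))); rewrite /P1; ring.
have dP1 (t : R) : is_derive (t : R) 1 P1 (P2 t).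
  by apply: (is_derive_eq (derZ _ (dlin t))); rewrite /P2; ring.
have touchE (z' : 'rV[R]_(N + M)) :
    A (sqx z') + G (sqx z') * P (sqy z0 z') = sing N p (sqx z') - Psi z'.
  by rewrite /A /G /P /sing -/L -/sg /Psi -/al -/B; ring.
have le_u' : \forall z' \near z,
    u z' <= A (sqx z') + G (sqx z') * P (sqy z0 z').
  by apply: filterS le_u => z'; rewrite touchE.
have eq_u' : u z = A Q + G Q * P S by rewrite touchE.
have [C2 _ _] := su.
have := laplacian_le_of_touching C2 Q0 dA dA1 dG dG1 dP dP1 le_u' eq_u'.
rewrite -/Q -/S (laplacian_ratio hN hp su)// -/Q.
set fv := `|_| `^ _ * _.
set rhs := (X in _ <= X).
have -> : rhs = - (L * Q `^ (- sg) / Q) * ell N p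
    - q * Q `^ al / Q * (4 * B2 Q - (N%:R - 2) ^+ 2 / 4 * B Q) * P S
    - q * Q `^ al * B Q * (4 * S * P2 S + 2 * M%:R * P1 S).
  rewrite /rhs /A1 /A2 /G1 /G2 /G /ell -/sg.
  have -> : N%:R = 2 - 4 * al :> R by rewrite /al; field.
  by field; rewrite gt_eqF.
move=> lap.
have qal0 : 0 < q * Q `^ al by rewrite mulr_gt0// powR_gt0.
have P0 : 0 <= P S by rewrite /P -expr2 sqr_ge0.
have B0 : 0 <= B Q by exact: sqr_ge0.
have hB2 : - (q * Q `^ al / Q * (4 * B2 Q - (N%:R - 2) ^+ 2 / 4 * B Q) * P S) <=
    q * Q `^ al / Q * (((N%:R - 2) ^+ 2 / 4 + 8 * e ^+ 2) * B Q) * P S.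
  rewrite -mulNr -mulrN ler_wpM2r// ler_wpM2l//.
    by apply: divr_ge0; exact: ltW.
  by have := bump2_ge e Q0 (lt0r_neq0 a0); rewrite -/B2 -/B; lra.
have hP : - (q * Q `^ al * B Q * (4 * S * P2 S + 2 * M%:R * P1 S)) <=
    q * Q `^ al * B Q * (e ^+ 2 / Q * P S).
  rewrite -mulrN; apply: ler_wpM2l; first by rewrite mulr_ge0// ltW.
  have := @transverse_bump_ge R M%:R rho S (ler0n _ _) rho0.
  have -> : (1 - rho * S) ^+ 2 = P S by rewrite /P; ring.
  rewrite (_ : 4 * S * P2 S + _ = 4 * S * (2 * rho ^+ 2) +
    2 * M%:R * (- 2 * rho * (1 - rho * S))); last by rewrite /P1 /P2; ring.
  have : rho * ((2 + M%:R) ^+ 2 / 2) * P S <= e ^+ 2 / Q * P S.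
    by apply: ler_wpM2r => //; rewrite ler_pdivlMr.
  rewrite mulNr; lra.
have Psi_eq : q * Q `^ al * B Q * P S = sing N p Q * (1 - ratio p u z).
  have := eq_u; rewrite {1}(ratioE u hN hp)// -/Q /Psi -/Q -/S -/al -/B => E.
  rewrite mulrBr mulr1 E /P; ring.
set mu := (_ / 4 + _ : R).
have pref_gt0 : 0 < sing N p Q / Q by rewrite divr_gt0// sing_gt0.
rewrite -(ler_pM2l pref_gt0).
have -> : sing N p Q / Q * (mu * (1 - ratio p u z)) =
    mu * (q * Q `^ al * B Q * P S) / Q by rewrite Psi_eq; ring.
move: lap; rewrite -/(sing N p Q) => lap.
have E1 : q * Q `^ al / Q * (((N%:R - 2) ^+ 2 / 4 + 8 * e ^+ 2) * B Q) * P S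
    + q * Q `^ al * B Q * (e ^+ 2 / Q * P S) =
    mu * (q * Q `^ al * B Q * P S) / Q.
  by rewrite /mu; field; rewrite gt_eqF.
rewrite -E1 mulrBr mulr1 mulrBr.
have E2 : L * Q `^ (- sg) / Q * ell N p = sing N p Q / Q * ell N p by [].
by move: lap hB2 hP; rewrite mulNr E2; lra.
Qed.

(** For fixed z0, use the bump supported where |x| is comparable to |x0| and
    |y - y0| is bounded by a multiple of |x0|.   On the support, maximize Psi / (phi - u); the denominator
    is positive by [ratio_lt1].  At a maximum point z the multiple of Psi
    below phi - u touches it, whence 1 - v(z) >= 1 - th.  Comparing the
    quotients at z and z0 transfers this bound to z0 with a loss that depends
    only on |x|^2 / |x0|^2, which stays in a fixed compact interval. *)
Lemma ratio_gap (R : realType) (N M : nat) (p : R)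
    (u : 'rV[R]_(N + M) -> R) :
  (3 <= N)%N -> p_sg R N < p -> subsingular p u ->
  4 * decay p <= N%:R - 2 -> (N%:R - 2) ^+ 2 / 4 < p * ell N p ->
  exists2 eta, 0 < eta < 1 &
    forall z : 'rV[R]_(N + M), 0 < sqx z -> ratio p u z <= 1 - eta.
Proof.
move=> hN hp su hsg hH.
have L0 := L_const_gt0 hN hp.
have sg0 := decay_gt0 hN hp.
have ell0 := ell_gt0 hN hp.
have p1 := p_gt1 hN hp.
have N3 := N_ge3 R hN.
have M0 : 0 <= M%:R :> R by [].
set H := _ / 4 in hH.
have H0 : 0 < H by rewrite divr_gt0// exprn_gt0//; lra.
(* e is small enough for the constant mu below to stay under p ell. *)
pose e := Num.min 1 ((p * ell N p - H) / 18).
have e0 : 0 < e by rewrite lt_min ltr01/=; lra.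
have e1 : e <= 1 by rewrite ge_min lexx.
have e2 : e <= (p * ell N p - H) / 18 by rewrite ge_min lexx orbT.
pose mu := H + 9 * e ^+ 2.
have mu_lt : mu < p * ell N p.
  have : e ^+ 2 <= e by rewrite expr2 ler_piMr// ltW.
  by rewrite /mu; lra.
have mu0 : 0 < mu by rewrite /mu addr_gt0// mulr_gt0// exprn_gt0.
have pell0 : 0 < p * ell N p by rewrite mulr_gt0//; lra.
pose th := (mu / (p * ell N p)) `^ decay p.
have th0 : 0 < th by rewrite powR_gt0// divr_gt0.
have th1 : th < 1.
  have := @gt0_ltr_powR R (decay p) sg0 (mu / (p * ell N p)) 1.
  rewrite !nnegrE powR1; apply => //; first by rewrite divr_ge0// ltW.
  by rewrite ltr_pdivrMr// mul1r.
pose ka : R := (N%:R - 2) / 4.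
have hka : 0 <= ka - decay p by rewrite /ka; lra.
pose gam := 4^-1 `^ ((ka - decay p) / e) : R.
have gam0 : 0 < gam by rewrite powR_gt0// invr_gt0.
have gam1 : gam <= 1.
  rewrite /gam -[leRHS](powRr0 4^-1) ger_powR//; last first.
    by apply: divr_ge0 => //; exact: ltW.
  by apply/andP; split; lra.
exists ((1 - th) * gam).
  apply/andP; split; first by rewrite mulr_gt0//; lra.
  by rewrite (@le_lt_trans _ _ ((1 - th) * 1))// ?ler_wpM2l//; lra.
move=> z0 Q00.
pose a := sqx z0 `^ e.
have a0 : 0 < a by rewrite powR_gt0.
(* On the support of the bump, |x|^2 is at most b. *)
pose b := (4 * a) `^ e^-1.
have b0 : 0 < b by rewrite powR_gt0// mulr_gt0.
pose k : R := (2 + M%:R) ^+ 2 / 2.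
have k0 : 0 < k by rewrite divr_gt0// exprn_gt0//; lra.
pose rho := e ^+ 2 / (k * b).
have rho0 : 0 < rho by rewrite divr_gt0 ?exprn_gt0// mulr_gt0.
pose x (z : 'rV[R]_(N + M)) := sqx z `^ e / a.
(* The support of the bump: the first condition says x + 1 / x <= 4, cleared of the
   denominator so that it is closed up to the axis. *)
pose K := [set z : 'rV[R]_(N + M) |
  x z ^+ 2 + 1 - 4 * x z <= 0 /\ rho * sqy z0 z <= 1].
have x_gt0 (z : 'rV[R]_(N + M)) : x z ^+ 2 + 1 - 4 * x z <= 0 -> 0 < x z.
  by have := sqr_ge0 (x z); lra.
have x_lt4 (z : 'rV[R]_(N + M)) : x z ^+ 2 + 1 - 4 * x z <= 0 -> x z <= 4.
  by move=> h; have := x_gt0 z h; nra.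
have x_gt4 (z : 'rV[R]_(N + M)) : x z ^+ 2 + 1 - 4 * x z <= 0 -> 4^-1 <= x z.
  by move=> h; have := x_gt0 z h; have := x_lt4 z h; nra.
have Q_gt0 (z : 'rV[R]_(N + M)) : x z ^+ 2 + 1 - 4 * x z <= 0 -> 0 < sqx z.
  move=> /x_gt0; rewrite pmulr_lgt0 ?invr_gt0// => h.
  rewrite lt_neqAle sqx_ge0 andbT; apply/eqP => Qz.
  by move: h; rewrite -Qz powR0 ?ltxx// gt_eqF.
have Q_le (z : 'rV[R]_(N + M)) : x z ^+ 2 + 1 - 4 * x z <= 0 -> sqx z <= b.
  move=> /x_lt4; rewrite ler_pdivrMr// => h.
  have -> : sqx z = (sqx z `^ e) `^ e^-1.
    by rewrite -powRrM mulfV ?gt_eqF// powRr1// sqx_ge0.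
  rewrite /b.
  apply: ge0_ler_powR => //; rewrite ?nnegrE ?powR_ge0//.
    by rewrite invr_ge0 ltW.
  by apply: mulr_ge0 => //; exact: ltW.
have cshE (z : 'rV[R]_(N + M)) : 0 < sqx z -> coshlog e a (sqx z) = x z + (x z)^-1.
  move=> Qz; rewrite /coshlog /x powRN; field.
  by rewrite !gt_eqF// powR_gt0.
have csh_le (z : 'rV[R]_(N + M)) : x z ^+ 2 + 1 - 4 * x z <= 0 ->
    2 <= coshlog e a (sqx z) <= 4.
  move=> h; have x0 := x_gt0 z h; rewrite cshE ?Q_gt0//.
  have -> : x z + (x z)^-1 = (x z ^+ 2 + 1) / x z by field; rewrite gt_eqF.
  rewrite ler_pdivlMr// ler_pdivrMr//.
  by have := sqr_ge0 (x z - 1); rewrite sqrrB1 => ?; apply/andP; split; lra.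
have cx : continuous x.
  move=> z; have cq := @continuous_sqx_powR R N M e e0 z.
  exact: (continuousM cq (@cst_continuous 'rV[R]_(N + M) R a^-1 z)).
have cS : continuous (fun z => rho * sqy z0 z).
  move=> z; have cs := @continuous_sqy R N M z0 z.
  exact: (continuousM (@cst_continuous 'rV[R]_(N + M) R rho z) cs).
have cxx : continuous (fun z => x z ^+ 2 + 1 - 4 * x z).
  move=> z; have cc (r : R) := @cst_continuous 'rV[R]_(N + M) R r z.
  exact: (continuousB (continuousD (continuousM (cx z) (cx z)) (cc 1))
    (continuousM (cc 4) (cx z))).
have cK : compact K.
  apply: bounded_closed_compact.
    exists (`|z0| + 1 + b + rho^-1); split; first exact: num_real.
    move=> r hr z [h1 h2]; apply: le_trans (ltW hr).
    apply: le_trans (norm_le_sqx_sqy z0 z) _.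
    have := Q_le z h1.
    have : sqy z0 z <= rho^-1.
      by rewrite -[leRHS]mul1r ler_pdivlMr// mulrC.
    by lra.
  have -> : K = [set z | x z ^+ 2 + 1 - 4 * x z <= 0] `&`
                [set z | rho * sqy z0 z <= 1] by [].
  apply: closedI.
    by apply: closed_comp (@closed_le _ 0) => z _; exact: cxx.
  by apply: closed_comp (@closed_le _ 1) => z _; exact: cS.
pose Psi (z : 'rV[R]_(N + M)) := sqx z `^ (- ka) * bump e a (sqx z) *
  (1 - rho * sqy z0 z) ^+ 2.
pose w (z : 'rV[R]_(N + M)) := sing N p (sqx z) - u z.
have wE (z : 'rV[R]_(N + M)) : 0 < sqx z -> w z = sing N p (sqx z) * (1 - ratio p u z).
  by move=> Qz; rewrite /w {1}(ratioE u hN hp)//; ring.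
have w_gt0 (z : 'rV[R]_(N + M)) : 0 < sqx z -> 0 < w z.
  move=> Qz; rewrite wE// mulr_gt0 ?sing_gt0//.
  by have := ratio_lt1 hN hp su Qz; lra.
have cF : {within K, continuous (fun z => Psi z / w z)}.
  apply: continuous_in_subspaceT => z; rewrite inE => -[h1 h2].
  have Qz := Q_gt0 z h1.
  have cc (r : R) := @cst_continuous 'rV[R]_(N + M) R r z.
  have cq (r : R) := @continuous_at_sqx_powR R N M r z Qz.
  have [[cu _] _ _] := su.
  have cw : {for z, continuous w}.
    exact: (continuousB (continuousM (cc (L_const N p)) (cq (- decay p))) (cu z)).
  have ccosh := continuousD (continuousM (cc a^-1) (cq e))
    (continuousM (cc a) (cq (- e))).
  have c4 := continuousB (cc 4) ccosh.
  have c1 := continuousB (cc 1) (cS z).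
  have w0 : w z != 0 by rewrite gt_eqF// w_gt0.
  exact: (continuousM (continuousM (continuousM (cq (- ka))
    (continuousM c4 c4)) (continuousM c1 c1)) (continuousV w0 cw)).
have xz0 : x z0 = 1 by rewrite /x divff// gt_eqF.
have Kz0 : K z0.
  by split; rewrite ?xz0 ?sqy_center ?mulr0//; lra.
have Psi0 : Psi z0 = 4 * sqx z0 `^ (- ka).
  by rewrite /Psi /bump cshE// xz0 sqy_center invr1; ring.
have [z /set_mem [Kz1 Kz2] zmax] := EVT_max_rV (ex_intro _ _ Kz0) cK cF.
have Qz := Q_gt0 z Kz1.
have Psiz_gt0 : 0 < Psi z.
  have : 0 < Psi z / w z.
    apply: lt_le_trans (zmax z0 (mem_set Kz0)).
    by rewrite divr_gt0 ?w_gt0// Psi0 mulr_gt0// powR_gt0.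
  by rewrite pmulr_lgt0// invr_gt0 w_gt0.
pose q := w z / Psi z.
have q0 : 0 < q by rewrite divr_gt0// w_gt0.
have Kz1' : x z ^+ 2 + 1 - 4 * x z < 0.
  rewrite lt_neqAle Kz1 andbT; apply/eqP => E.
  have xz := x_gt0 z Kz1.
  move: Psiz_gt0; rewrite /Psi /bump cshE//.
  have -> : x z + (x z)^-1 = 4.
    have -> : x z + (x z)^-1 = (x z ^+ 2 + 1) / x z by field; rewrite gt_eqF.
    have -> : x z ^+ 2 + 1 = 4 * x z by lra.
    by field; rewrite gt_eqF.
  by rewrite subrr expr0n mulr0 mul0r ltxx.
have Kz2' : rho * sqy z0 z < 1.
  rewrite lt_neqAle Kz2 andbT; apply/eqP => E.
  by move: Psiz_gt0; rewrite /Psi E subrr expr0n mulr0 ltxx.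
have nearK : \forall z' \near z, K z'.
  near=> z'; split; apply: ltW; near: z'.
    exact: (cvgr_lt _ (cxx z) _ Kz1').
  exact: (cvgr_lt _ (cS z) _ Kz2').
have le_w (z' : 'rV[R]_(N + M)) : K z' -> q * Psi z' <= w z'.
  move=> Kz'; have := zmax z' (mem_set Kz').
  have wz' := w_gt0 z' (Q_gt0 z' Kz'.1).
  rewrite ler_pdivrMr// => h.
  have -> : w z' = q * (Psi z / w z * w z').
    by rewrite /q; field; rewrite !gt_eqF// w_gt0.
  by rewrite ler_pM2l.
have hrho : rho * ((2 + M%:R) ^+ 2 / 2) * sqx z <= e ^+ 2.
  rewrite -/k.
  have -> : e ^+ 2 = rho * k * b by rewrite /rho; field; rewrite !gt_eqF.
  by rewrite ler_pM2l; [exact: Q_le|exact: mulr_gt0].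
have le_u : \forall z' \near z, u z' <= sing N p (sqx z') -
    q * (sqx z' `^ (- ka) * bump e a (sqx z')) * (1 - rho * sqy z0 z') ^+ 2.
  apply: filterS nearK => z' /le_w.
  by rewrite /Psi /w mulrA; lra.
have eq_u : u z = sing N p (sqx z) -
    q * (sqx z `^ (- ka) * bump e a (sqx z)) * (1 - rho * sqy z0 z) ^+ 2.
  have : q * Psi z = w z by rewrite /q divfK// gt_eqF.
  by rewrite /Psi /w mulrA; lra.
have := ratio_touching_bump hN hp su a0 (ltW rho0) q0 Qz hrho le_u eq_u.
rewrite -/H -/mu => /(le_of_chord_slope p1 ell0 (ratio_lt1 hN hp su Qz)).
rewrite -/th => vth.
have Psi_le : Psi z <= 4 * sqx z `^ (- ka).
  have /andP[c2 c4] := csh_le z Kz1.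
  have B4 : 0 <= bump e a (sqx z) <= 4.
    rewrite /bump sqr_ge0/=; set c := coshlog _ _ _ in c2 c4 *.
    by nra.
  have P1 : 0 <= (1 - rho * sqy z0 z) ^+ 2 <= 1.
    have : 0 <= rho * sqy z0 z by rewrite mulr_ge0 ?sqy_ge0// ltW.
    rewrite sqr_ge0/=; set s := rho * _ in Kz2' *.
    by nra.
  move: B4 P1 => /andP[B0 B4] /andP[P0 P1].
  rewrite /Psi -mulrA [leRHS]mulrC ler_pM2l ?powR_gt0//.
  by rewrite -[4]mulr1 ler_pM.
have hw : 4 * sqx z0 `^ (- ka) * w z <= w z0 * Psi z.
  have := zmax z0 (mem_set Kz0).
  rewrite Psi0 ler_pdivrMr ?w_gt0// mulrAC ler_pdivlMr ?w_gt0//.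
  by lra.
have hwz : sing N p (sqx z) * (1 - th) <= w z.
  by rewrite wE// ler_pM2l ?sing_gt0//; lra.
have hgam : gam <= (x z) `^ ((ka - decay p) / e).
  apply: ge0_ler_powR; rewrite ?nnegrE ?invr_ge0 ?x_gt4//.
    by apply: divr_ge0 => //; exact: ltW.
  by apply: ltW; exact: x_gt0.
have xzE : (x z) `^ ((ka - decay p) / e) * sqx z0 `^ (ka - decay p) =
    sqx z `^ (ka - decay p).
  rewrite (_ : sqx z0 `^ (ka - decay p) = a `^ ((ka - decay p) / e)); last first.
    by rewrite /a -powRrM mulrCA mulfV ?gt_eqF// mulr1.
  rewrite -powRM ?(ltW a0)// ?(ltW (x_gt0 z Kz1))//.
  by rewrite /x divfK ?gt_eqF// -powRrM mulrCA mulfV ?gt_eqF// mulr1.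
have h1 : 4 * sqx z0 `^ (- ka) * (sing N p (sqx z) * (1 - th)) <=
    sing N p (sqx z0) * (1 - ratio p u z0) * (4 * sqx z `^ (- ka)).
  rewrite -(wE z0 Q00).
  apply: le_trans (le_trans _ hw) _; first by rewrite ler_pM2l// mulr_gt0// powR_gt0.
  by rewrite ler_pM2l// w_gt0.
have split_pow (t : R) : 0 < t -> t `^ (- decay p) = t `^ (ka - decay p) * t `^ (- ka).
  move=> t0; rewrite -powRD; last by apply/implyP => _; rewrite gt_eqF.
  by congr (_ `^ _); ring.
have h2 : (1 - th) * sqx z `^ (ka - decay p) <=
    (1 - ratio p u z0) * sqx z0 `^ (ka - decay p).
  have pos : 0 < 4 * sqx z0 `^ (- ka) * sqx z `^ (- ka) * L_const N p.
    by rewrite !mulr_gt0 ?powR_gt0.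
  rewrite -(ler_pM2l pos).
  move: h1; rewrite /sing (split_pow _ Q00) (split_pow _ Qz); lra.
have h3 : (1 - th) * gam <= 1 - ratio p u z0.
  have pos : 0 < sqx z0 `^ (ka - decay p) by rewrite powR_gt0.
  rewrite -(ler_pM2r pos); apply: le_trans h2; rewrite -xzE -mulrA.
  by rewrite ler_pM2l; [rewrite ler_pM2r|lra].
by lra.
Unshelve. all: by end_near. Qed.

(** * The Liouville theorem *)

(** With s = 2 sg one has p ell = (s + 2) (N - 2 - s), and the inequality is
    equivalent to |t| < r for t = (N - 4) / 2 - s and r = sqrt (N - 1).  The
    hypothesis 4 sg <= N - 2 gives t >= -1 > - r.  For N <= 10 one has
    (N - 4) / 2 <= r, hence t < r; for N > 10, t >= r would mean
    2 s <= (r + 1) (r - 3), which is p >= p_JL after factoring numerator and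
    denominator of p_JL as polynomials in r. *)
Lemma hardy_of_p_JL (R : realType) (N : nat) (p : R) :
  (3 <= N)%N -> p_sg R N < p -> (p%:E < p_JL R N)%E ->
  4 * decay p <= N%:R - 2 -> (N%:R - 2) ^+ 2 / 4 < p * ell N p.
Proof.
move=> hN hp hJL hsg.
have p1 := p_gt1 hN hp; have sg0 := decay_gt0 hN hp.
have N3 := N_ge3 R hN.
have sgp : p * decay p = decay p + 1.
  by have := decayE hN hp; lra.
pose s := 2 * decay p.
have -> : p * ell N p = (s + 2) * (N%:R - 2 - s).
  rewrite /ell -/s.
  have -> : p * (s * (N%:R - 2 - s)) = 2 * (p * decay p) * (N%:R - 2 - s).
    by rewrite /s; ring.
  by rewrite sgp /s; ring.
pose r := Num.sqrt (N%:R - 1) : R.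
have r0 : 0 <= r by exact: sqrtr_ge0.
have r2 : r ^+ 2 = N%:R - 1 by rewrite sqr_sqrtr//; lra.
have r1 : 1 < r by nra.
pose t := (N%:R - 4) / 2 - s.
suff tr : t < r.
  have : t ^+ 2 < r ^+ 2 by rewrite /t /s in tr *; nra.
  by rewrite r2 /t; lra.
move: hJL; rewrite /p_JL; case: ifPn => [N10 | N10 _].
  rewrite lte_fin -/r => hJL; rewrite ltNge; apply/negP => rt.
  have N11 : 11 <= N%:R :> R by rewrite ler_nat.
  have Nr : N%:R = r ^+ 2 + 1 :> R by rewrite r2; ring.
  move: hJL; rewrite ltr_pdivlMr; last by rewrite mulr_gt0//; lra.
  have r3 : 3 < r by nra.
  rewrite Nr.
  have -> : p * ((r ^+ 2 + 1 - 2) * (r ^+ 2 + 1 - 10)) =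
      ((r - 1) * (r + 3)) * (p * ((r + 1) * (r - 3))) by ring.
  have -> : (r ^+ 2 + 1 - 2) ^+ 2 - 4 * (r ^+ 2 + 1) + 8 * r =
      ((r - 1) * (r + 3)) * (r - 1) ^+ 2 by ring.
  rewrite ltr_pM2l; last by rewrite mulr_gt0//; lra.
  have hs : 2 * s <= (r + 1) * (r - 3) by move: rt; rewrite /t Nr; lra.
  have : 4 <= (p - 1) * ((r + 1) * (r - 3)).
    have -> : 4 = (p - 1) * (2 * s) by have := decayE hN hp; rewrite /s; lra.
    by rewrite ler_pM2l//; lra.
  by lra.
have N10' : N%:R <= 10 :> R by rewrite ler_nat leqNgt.
have s0 : 0 < s by rewrite /s; lra.
rewrite /t; nra.
Qed.

(** The sign of b separates the subcritical range, where the barrier argument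
    applies directly, from the range where the gap below 1 supplies
    the constant c. *)
Lemma ratio_le0 (R : realType) (N M : nat) (p : R)
    (u : 'rV[R]_(N + M) -> R) (z : 'rV[R]_(N + M)) :
  (3 <= N)%N -> p_sg R N < p -> (p%:E < p_JL R N)%E -> subsingular p u ->
  0 < sqx z -> ratio p u z <= 0.
Proof.
move=> hN hp hJL su Qz.
have p1 := p_gt1 hN hp; have sg0 := decay_gt0 hN hp.
have ell0 := ell_gt0 hN hp.
pose b := 4 * decay p - N%:R + 2.
have [b0|b0] := ltP 0 b.
  pose k := Num.min 1 (b / 4).
  have k0 : 0 < k by rewrite lt_min ltr01/=; lra.
  have k1 : k <= 1 by rewrite ge_min lexx.
  have kb : k <= b / 4 by rewrite ge_min lexx orbT.
  apply: (ratio_le0_barrier hN hp su k0 k1 (lexx 0)) => //.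
    rewrite -/b; nra.
  move=> z' Qz' v0; rewrite mul0r; apply: mulr_ge0; first exact: ltW.
  have := ratio_norm_le1 hN hp su z'; rewrite gtr0_norm// => v1.
  have : ratio p u z' `^ (p - 1) <= 1.
    have := @ge0_ler_powR R (p - 1) _ (ratio p u z') 1.
    by rewrite !nnegrE powR1; apply => //; lra.
  by move=> h; rewrite subr_ge0 ler_piMl// ltW.
have hsg : 4 * decay p <= N%:R - 2 by move: b0; rewrite /b; lra.
have [eta /andP[eta0 eta1] gap] :=
  ratio_gap hN hp su hsg (hardy_of_p_JL hN hp hJL hsg).
pose th := (1 - eta) `^ (p - 1).
have th1 : th < 1.
  have := @gt0_ltr_powR R (p - 1) _ (1 - eta) 1.
  by rewrite !nnegrE powR1; apply => //; lra.
pose c := ell N p * (1 - th).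
have c0 : 0 < c by rewrite mulr_gt0//; lra.
pose k := Num.min 1 (c / (4 * (2 - b))).
have k0 : 0 < k by rewrite lt_min ltr01/= divr_gt0//; lra.
have k1 : k <= 1 by rewrite ge_min lexx.
have kc : k * (4 * (2 - b)) <= c.
  by rewrite -ler_pdivlMr ?ge_min ?lexx ?orbT//; lra.
apply: (ratio_le0_barrier hN hp su k0 k1 (ltW c0)) => //.
  by rewrite -/b; nra.
move=> z' Qz' v0; rewrite /c -mulrA ler_pM2l// mulrBl mul1r lerB//.
rewrite ler_pM2r// gtr0_norm// ge0_ler_powR ?nnegrE ?gap//; lra.
Qed.

Lemma subsingular_opp (R : realType) (N M : nat) (p : R)
    (u : 'rV[R]_(N + M) -> R) :
  subsingular p u -> subsingular p (fun z => - u z).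
Proof.
move=> [[cu du] eq_u bd].
have pN i : partial i (fun z => - u z) = (fun z => - partial i u z).
  by apply/funext => z; rewrite /partial; apply: deriveN; exact: (du i).1.
have ppN i j : partial j (fun z => - partial i u z) =
    (fun z => - partial j (partial i u) z).
  apply/funext => z; rewrite [LHS]/partial; apply: deriveN.
  exact: ((du i).2.2 j).1.
split.
- split; first by move=> z; apply: continuousN; exact: cu.
  move=> i; split; first by move=> z; apply: derivableN; exact: (du i).1.
  rewrite pN; have [_ [cpu dpu]] := du i; split.
    by move=> z; apply: continuousN; exact: cpu.
  move=> j; split; first by move=> z; apply: derivableN; exact: (dpu j).1.
  by rewrite ppN => z; apply: continuousN; exact: (dpu j).2.
- move=> z; rewrite normrN mulrN.
  have -> : laplacian (fun z => - u z) z = - laplacian u z.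
    by rewrite /laplacian -sumrN; apply: eq_bigr => i _; rewrite pN ppN.
  by rewrite -opprD eq_u oppr0.
- by move=> z; rewrite normrN; exact: bd.
Qed.

Lemma subsingular_of_bound (R : realType) (N M : nat) (p : R)
    (u : 'rV[R]_(N + M) -> R) :
  class_C 2 u ->
  (forall z, laplacian u z + `|u z| `^ (p - 1) * u z = 0) ->
  (forall (x : 'rV[R]_N) (y : 'rV[R]_M),
     x != 0 -> `|u (row_mx x y)| <= phi_infty p x) ->
  subsingular p u.
Proof.
move=> C2 eq_u bd; split=> // z Qz.
have E : \sum_(i < N) lsubmx z ord0 i ^+ 2 = sqx z.
  by apply: eq_bigr => i _; rewrite mxE.
rewrite -{1}(hsubmxK z); apply: le_trans (bd _ _ _) _.
  apply/eqP => x0; move: Qz; rewrite -E x0 big1 ?ltxx// => i _.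
  by rewrite mxE expr0n.
rewrite /phi_infty /sing /euclid_norm E -powR12_sqrt ?sqx_ge0// -powRrM.
rewrite (_ : 2^-1 * (-2 / (p - 1)) = - decay p)//.
by rewrite /decay mulrA mulrN mulVf ?mulN1r.
Qed.

Lemma eq0_off_axis (R : realType) (N M : nat) (u : 'rV[R]_(N + M) -> R) :
  (0 < N)%N -> continuous u -> (forall z, 0 < sqx z -> u z = 0) ->
  forall z, u z = 0.
Proof.
move=> N0 cu u0 z; have [Qz|Qz] := ltP 0 (sqx z); first exact: u0.
have {}Qz : sqx z = 0 by apply/eqP; rewrite eq_le Qz sqx_ge0.
pose i : 'I_N := Ordinal N0.
apply/eqP/negP => /negP uz.
have near_u : \forall z' \near z, u z' != 0.
  exact: (@cvgr_neq0 R R _ _ _ u (u z) (cu z) uz).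
have := near_line (basis_vec R (lshift M i)) near_u.
move=> /nbhs_ballP[d /= d0 hd].
have dd : ball (0 : R) d (d / 2).
  by rewrite /ball/= sub0r normrN gtr0_norm; lra.
have /eqP := hd _ dd; apply; apply: u0.
rewrite sqx_linel Qz.
rewrite (sqx_eq0_coord i Qz).
by rewrite mulr0 mul0r !add0r exprn_gt0//; lra.
Qed.

Theorem theorem2 (R : realType) (N M : nat) (p : R)
    (u : 'rV[R]_(N + M) -> R)
    (hN : (3 <= N)%N)
    (hp_sg : p_sg R N < p)
    (hp_JL : (p%:E < p_JL R N)%E)
    (hC2 : class_C 2 u)
    (hsol : forall z : 'rV[R]_(N + M),
        laplacian u z + `|u z| `^ (p - 1) * u z = 0)
    (hbound : forall (x : 'rV[R]_N) (y : 'rV[R]_M),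
        x != 0 -> `|u (row_mx x y)| <= phi_infty p x) :
  forall z : 'rV[R]_(N + M), u z = 0.
Proof.
have su := subsingular_of_bound hC2 hsol hbound.
apply: (eq0_off_axis (ltnW (ltnW hN)) hC2.1) => z Qz.
have := ratio_le0 hN hp_sg hp_JL su Qz.
have := ratio_le0 hN hp_sg hp_JL (subsingular_opp su) Qz.
rewrite (ratioE u hN hp_sg Qz) /ratio !mulNr oppr_le0 => h1 h2.
by rewrite (_ : _ / _ = 0) ?mulr0//; apply/eqP; rewrite eq_le h1 h2.
Qed.
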